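(* Let $X$ be a locally compact, connected Hausdorff space. Suppose a singleton-finite signed deficient topological measure $\mu$ on $X$ is the difference of two deficient topological measures on $X$, one of which is singleton-finite and the other finite. (i) There is a decomposition $\mu = m + \mu'$, where $m$ is a signed Radon measure and $\mu'$ is a proper singleton-finite signed deficient topological measure. (ii) If $\mu$ is the difference of two finite deficient topological measures, then there is a unique decomposition $\mu = m + \mu'$, where $m$ is a signed Radon measure, $\mu'$ is a proper signed deficient topological measure, and $\|m\|, \|\mu'\| < \infty$. (iii) If $\mu$ is a signed topological measure with $\|\mu\| < \infty$, then there is a unique decomposition $\mu = m + \mu'$, where $m$ is a signed Radon measure, $\mu'$ is a proper signed topological measure, and $\|m\|, \|\mu'\| < \infty$.
   Context: $\mathscr{O}(X)$, $\mathscr{C}(X)$, $\mathscr{K}(X)$ denote the collections of open, closed, compact subsets of $X$; $\sqcup$ denotes a disjoint union. Set functions into the extended reals are assumed not identically $\infty$ or $-\infty$. Relations between set functions (sums, equalities, inequalities) are on $\mathscr{O}(X)\cup\mathscr{C}(X)$; Borel measures are restricted to $\mathscr{O}(X)\cup\mathscr{C}(X)$. A deficient topological measure is $\nu:\mathscr{C}(X)\cup\mathscr{O}(X)\to[0,\infty]$ such that: $\nu(C\sqcup K)=\nu(C)+\nu(K)$ for disjoint compact $C,K$; $\nu(U)=\sup\{\nu(C): C\subseteq U, C\in\mathscr{K}(X)\}$ for $U$ open; $\nu(F)=\inf\{\nu(U): F\subseteq U, U\in\mathscr{O}(X)\}$ for $F$ closed. A signed deficient topological measure is $\nu:\mathscr{C}(X)\cup\mathscr{O}(X)\to[-\infty,\infty]$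 assuming at most one of $\infty,-\infty$ such that: $\nu(C\sqcup K)=\nu(C)+\nu(K)$ for disjoint compact $C,K$; $\nu(U)=\lim\{\nu(K):K\in\mathscr{K}(X), K\subseteq U\}$ for $U$ open (limit of the net indexed by compact subsets of $U$ ordered by inclusion); $\nu(F)=\lim\{\nu(U):U\in\mathscr{O}(X), F\subseteq U\}$ for $F$ closed (limit of the net indexed by open supersets ordered by reverse inclusion). A signed topological measure is defined in the same way, with the first condition replaced by: if $A,B,A\sqcup B\in\mathscr{K}(X)\cup\mathscr{O}(X)$ then $\mu(A\sqcup B)=\mu(A)+\mu(B)$. $\|\nu\|=\sup\{|\nu(K)|:K\in\mathscr{K}(X)\}$. $\nu$ is singleton-finite if $|\nu(\{x\})|<\infty$ for all $x\in X$; a nonnegative $\nu$ is finite if $\nu(X)<\infty$. A Radon measure is a Borel measure that is finite on compact sets, outer regular on all Borel sets (by open sets), and inner regular on all open sets (by compact sets). A signed Radon measure is a difference of two Radon measures, at least one of which is finite. The total variation $|\lambda|$ is defined by $|\lambda|(U)=\sup\{\sum_{i=1}^n|\lambda(K_i)|:\bigsqcup_{i=1}^nK_i\subseteq U, K_i\in\mathscr{K}(X), n\in\mathbb{N}\}$ for $U$ open, and $|\lambda|(F)=\inf\{|\lambda|(U):F\subseteq U, U\in\mathscr{O}(X)\}$ for $F$ closed. A signed deficient topological measure $\nu$ is proper if $m\le|\nu|$ with $m$ a Radon measure implies $m=0$. *)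

(* Defs.v *)
From mathcomp Require Import all_boot all_order all_algebra.
From mathcomp Require Import all_classical all_reals all_analysis.
Set Implicit Arguments.
Unset Strict Implicit.
Unset Printing Implicit Defensive.
Import Order.TTheory GRing.Theory Num.Theory.
Local Open Scope classical_set_scope.
Local Open Scope ring_scope.
Local Open Scope ereal_scope.

(* A set function on the open and closed subsets of [X] is represented by a
   total function [set X -> \bar R]; when [X] is Hausdorff, so that compact
   sets are closed, its values elsewhere are irrelevant below. *)
Definition open_or_closed {X : ptopologicalType} (A : set X) : Prop :=
  open A \/ closed A.

Definition open_or_compact {X : ptopologicalType} (A : set X) : Prop :=
  open A \/ compact A.

Definition compact_sub {X : ptopologicalType} (U : set X) : set (set X) :=
  [set K | compact K /\ K `<=` U].

Definition open_sup {X : ptopologicalType} (F : set X) : set (set X) :=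
  [set U | open U /\ F `<=` U].

(* The filters of tails of the two nets: compact subsets of [U] directed by
   inclusion, and open supersets of [F] directed by reverse inclusion. *)
Definition compact_net {X : ptopologicalType} (U : set X) :
    set_system (set X) :=
  filter_from (compact_sub U)
    (fun K0 => [set K | compact_sub U K /\ K0 `<=` K]).

Definition open_net {X : ptopologicalType} (F : set X) : set_system (set X) :=
  filter_from (open_sup F) (fun U0 => [set U | open_sup F U /\ U `<=` U0]).

Definition eq_oc {R : realType} {X : ptopologicalType}
    (nu lam : set X -> \bar R) : Prop :=
  forall A, open_or_closed A -> nu A = lam A.

Definition le_oc {R : realType} {X : ptopologicalType}
    (nu lam : set X -> \bar R) : Prop :=
  forall A, open_or_closed A -> nu A <= lam A.

(* Since [+oo + -oo = -oo] in [\bar R], a sum of set functions also has to be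
   required to be meaningful on every open or closed set. *)
Definition is_sum_oc {R : realType} {X : ptopologicalType}
    (nu lam1 lam2 : set X -> \bar R) : Prop :=
  forall A, open_or_closed A ->
    lam1 A +? lam2 A /\ nu A = lam1 A + lam2 A.

Definition is_diff_oc {R : realType} {X : ptopologicalType}
    (nu lam1 lam2 : set X -> \bar R) : Prop :=
  forall A, open_or_closed A ->
    lam1 A +? - lam2 A /\ nu A = lam1 A - lam2 A.

Definition not_identically {R : realType} {X : ptopologicalType}
    (nu : set X -> \bar R) (c : \bar R) : Prop :=
  exists2 A, open_or_closed A & nu A <> c.

Definition additive_compact {R : realType} {X : ptopologicalType}
    (nu : set X -> \bar R) : Prop :=
  forall C K, compact C -> compact K -> C `&` K = set0 ->
    nu (C `|` K) = nu C + nu K.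

Definition additive_open_compact {R : realType} {X : ptopologicalType}
    (nu : set X -> \bar R) : Prop :=
  forall A B, open_or_compact A -> open_or_compact B ->
    open_or_compact (A `|` B) -> A `&` B = set0 ->
    nu (A `|` B) = nu A + nu B.

Definition at_most_one_infinity {R : realType} {X : ptopologicalType}
    (nu : set X -> \bar R) : Prop :=
  (forall A, open_or_closed A -> nu A <> +oo) \/
  (forall A, open_or_closed A -> nu A <> -oo).

Record is_dtm {R : realType} {X : ptopologicalType}
    (nu : set X -> \bar R) : Prop := IsDTM {
  dtm_ge0 : forall A, open_or_closed A -> 0 <= nu A ;
  dtm_nontriv : not_identically nu +oo ;
  dtm_additive : additive_compact nu ;
  dtm_open : forall U, open U -> nu U = ereal_sup (nu @` compact_sub U) ;
  dtm_closed : forall F, closed F -> nu F = ereal_inf (nu @` open_sup F) }.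

Record is_signed_dtm {R : realType} {X : ptopologicalType}
    (nu : set X -> \bar R) : Prop := IsSignedDTM {
  sdtm_infty : at_most_one_infinity nu ;
  sdtm_nontriv_pinfty : not_identically nu +oo ;
  sdtm_nontriv_ninfty : not_identically nu -oo ;
  sdtm_additive : additive_compact nu ;
  sdtm_open : forall U, open U -> nu @ compact_net U --> nu U ;
  sdtm_closed : forall F, closed F -> nu @ open_net F --> nu F }.

Record is_signed_tm {R : realType} {X : ptopologicalType}
    (mu : set X -> \bar R) : Prop := IsSignedTM {
  stm_infty : at_most_one_infinity mu ;
  stm_nontriv_pinfty : not_identically mu +oo ;
  stm_nontriv_ninfty : not_identically mu -oo ;
  stm_additive : additive_open_compact mu ;
  stm_open : forall U, open U -> mu @ compact_net U --> mu U ;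
  stm_closed : forall F, closed F -> mu @ open_net F --> mu F }.

Definition sf_norm {R : realType} {X : ptopologicalType}
    (nu : set X -> \bar R) : \bar R :=
  ereal_sup [set `|nu K| | K in compact].

Definition singleton_finite {R : realType} {X : ptopologicalType}
    (nu : set X -> \bar R) : Prop :=
  forall x, `|nu [set x]| < +oo.

(* Meant for nonnegative set functions only. *)
Definition sf_finite {R : realType} {X : ptopologicalType}
    (nu : set X -> \bar R) : Prop :=
  nu [set: X] < +oo.

Definition borel (X : ptopologicalType) := g_sigma_algebraType (@open X).

Record is_radon {R : realType} {X : ptopologicalType}
    (m : {measure set (borel X) -> \bar R}) : Prop := IsRadon {
  radon_compact : forall K : set X, compact K -> m K < +oo ;
  radon_outer : forall A : set (borel X), measurable A ->
    m A = ereal_inf (m @` open_sup (A : set X)) ;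
  radon_inner : forall U : set X, open U ->
    m U = ereal_sup (m @` compact_sub U) }.

Definition is_signed_radon {R : realType} {X : ptopologicalType}
    (m : set X -> \bar R) : Prop :=
  exists m1 m2 : {measure set (borel X) -> \bar R},
    [/\ is_radon m1, is_radon m2,
        sf_finite (m1 : set X -> \bar R) \/ sf_finite (m2 : set X -> \bar R)
      & is_diff_oc m m1 m2].

Definition sf_variation_open {R : realType} {X : ptopologicalType}
    (lam : set X -> \bar R) (U : set X) : \bar R :=
  ereal_sup [set s | exists (n : nat) (K : 'I_n -> set X),
    [/\ forall i, compact (K i), trivIset [set: 'I_n] K,
        \bigcup_i K i `<=` U & s = \sum_(i < n) `|lam (K i)|]].

Definition sf_variation {R : realType} {X : ptopologicalType}
    (lam : set X -> \bar R) (A : set X) : \bar R :=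
  if `[< open A >] then sf_variation_open lam A
  else ereal_inf (sf_variation_open lam @` open_sup A).

Definition is_proper {R : realType} {X : ptopologicalType}
    (nu : set X -> \bar R) : Prop :=
  forall m : {measure set (borel X) -> \bar R}, is_radon m ->
    le_oc m (sf_variation nu) -> eq_oc m (fun=> 0).

Definition unique_decomposition {R : realType} {X : ptopologicalType}
    (D : (set X -> \bar R) -> (set X -> \bar R) -> Prop) : Prop :=
  exists m mu', D m mu' /\
    forall n nu', D n nu' -> eq_oc n m /\ eq_oc nu' mu'.

(* Main.v *)
Require Import Defs.
From mathcomp Require Import all_boot all_order all_algebra.
From mathcomp Require Import all_classical all_reals all_analysis.
From mathcomp Require Import lra.
From HB Require Import structures.
Set Implicit Arguments.
Unset Strict Implicit.
Unset Printing Implicit Defensive.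
Import Order.TTheory GRing.Theory Num.Theory.
Local Open Scope classical_set_scope.
Local Open Scope ring_scope.
Local Open Scope ereal_scope.

(** Existence and uniqueness both reduce to measure-like estimates for set
functions [nu] that are merely monotone, superadditive on disjoint open sets
and locally finite ([is_superadditive]); deficient topological measures and
total variations restrict to such functions on open sets.

The largest Radon measure below [nu] is built directly.  For [K] compact let
[cover_content nu K] be the infimum of [\sum_i nu (U_i)] over finite open covers
of [K].  It is subadditive because covers can be concatenated, and additive on
disjoint compact sets because these have disjoint neighborhoods [V] and [W], and
superadditivity gives [nu (U `&` V) + nu (U `&` W) <= nu U].  So it is a content,
and Caratheodory's construction turns it into a Radon measure ([content_radon])
that lies below [nu] on open sets and above [cover_content nu] on compact sets
([max_radon]).  Hence if no nonzero Radon measure lies below [nu], then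
[cover_content nu] vanishes on compact sets; this property, [cover_null], is
the usable form of properness.

For a deficient topological measure [nu] with finite singletons and the above
[m], monotonicity of [nu - m] on compact sets makes it a deficient topological
measure [nu'], and [m K + cover_content nu' K <= cover_content nu K <= m K], so
[nu'] is [cover_null] ([dtm_decomposition]).

The other main step is [radon_le_of_cover_null]: if a Radon measure [m]
satisfies [m C <= nu U + t C] whenever [C] is a compact subset of the open set
[U], with [nu] a [cover_null] function and [t] monotone and superadditive on
compact sets, then [m <= t] on compact sets.  Indeed, given a cover of [K] of
small total [nu], the measure of [K] is approximated by that of finitely many
disjoint compact pieces, one in each member of the cover; the values of [nu] add
up to little, those of [t] to at most [t K].

It follows that sums of [cover_null] functions are [cover_null]
([cover_nullD]).  For [mu = mu1 - mu2] with [mu1 = m1 + nu1], [mu2 = m2 + nu2],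
the variation of [nu1 - nu2] is at most [nu1 + nu2], so [nu1 - nu2] is proper
([signed_dtm_decomposition]).  For uniqueness, if
[m1 - m2 + mu' = n1 - n2 + nu'] with finite Radon measures and finite norms,
then [m1 + n2 <= n1 + m2 + |mu'| + |nu'|] on compact sets, where the variations
are [cover_null]; so [m1 + n2 <= n1 + m2], and equality follows by symmetry
([decomposition_unique]). *)

(** * Separation of compact sets *)

Section topology.
Context {X : ptopologicalType}.
Implicit Types A B C K U V W : set X.

(** A property that is stable under finite unions and subsets passes from small
open sets to compact sets, by choosing a finite subcover. *)
Lemma compact_induction (P : set X -> Prop) K : compact K ->
  P set0 -> (forall A B, P A -> P B -> P (A `|` B)) ->
  (forall A B, A `<=` B -> P B -> P A) ->
  (forall x, K x -> exists U, [/\ open U, U x & P U]) -> P K.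
Proof.
move=> cK P0 PU Psub Ploc.
have /choice[f fP] (x : X) : exists U, K x -> [/\ open U, U x & P U].
  have [/Ploc[U UP]|nKx] := pselect (K x); first by exists U.
  by exists set0.
move: cK; rewrite compact_cover => /(_ X K f)[||D DK KD].
- by move=> x /fP[].
- by move=> x Kx; exists x => //; have [] := fP x Kx.
apply: Psub KD _; rewrite /cover bigcup_fset big_seq.
by apply: (big_ind P) => // x /DK; rewrite inE => /fP[].
Qed.

Definition open_separated A B := exists V W,
  [/\ open V, open W, A `<=` V, B `<=` W & V `&` W = set0].

Lemma open_separatedC A B : open_separated A B -> open_separated B A.
Proof. by move=> [V [W [oV oW AV BW VW]]]; exists W, V; rewrite setIC. Qed.

Lemma open_separated0 A : open_separated A set0.
Proof.
by exists setT, set0; rewrite setI0; split; [exact: openT|exact: open0|..].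
Qed.

Lemma open_separatedS A B B' :
  B' `<=` B -> open_separated A B -> open_separated A B'.
Proof.
move=> BB' [V [W [oV oW AV BW VW]]]; exists V, W; split => //.
exact: subset_trans BW.
Qed.

Lemma open_separatedU A B B' : open_separated A B -> open_separated A B' ->
  open_separated A (B `|` B').
Proof.
move=> [V [W [oV oW AV BW VW]]] [V' [W' [oV' oW' AV' BW' VW']]].
exists (V `&` V'), (W `|` W'); split.
- exact: openI.
- exact: openU.
- by rewrite subsetI.
- exact: setUSS.
- by rewrite setIUr (setIC V) -setIA VW setI0 set0U setIAC setIC VW' setI0.
Qed.

Lemma compact_open_separated A K : compact K ->
  (forall x, K x -> open_separated A [set x]) -> open_separated A K.
Proof.
move=> cK loc; apply: (compact_induction (P := open_separated A) cK).
- exact: open_separated0.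
- exact: open_separatedU.
- by move=> B B'; exact: open_separatedS.
- move=> x /loc[V [W [oV oW AV xW VW]]]; exists W; split => //.
    exact: xW.
  by exists V, W; split.
Qed.

Hypothesis X_haus : hausdorff_space X.

Lemma disjoint_compact_separated C K : compact C -> compact K ->
  C `&` K = set0 -> open_separated C K.
Proof.
move=> cC cK CK; apply: compact_open_separated cK _ => y Ky.
apply/open_separatedC/compact_open_separated => // x Cx.
have xy : x != y.
  by apply/eqP => xy; rewrite -[False]/(set0 y) -CK; split; rewrite // -xy.
move: X_haus; rewrite open_hausdorff => /(_ x y xy)[[V W]] /=.
rewrite !inE => -[Vx Wy] [oV oW VW].
exists W, V; split => //; last by rewrite setIC (VW : V `&` W = set0).
- by move=> _ ->.
- by move=> _ ->.
Qed.

Lemma compact_setD K U : compact K -> open U -> compact (K `\` U).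
Proof.
by move=> cK oU; rewrite setDE; apply: compact_closedI => //; exact: open_closedC.
Qed.

(** The parts of [K] outside [U] and outside [V] are disjoint compact sets, hence
have disjoint open neighborhoods; removing each neighborhood from [K] leaves one
of the two pieces. This needs the Hausdorff property only. *)
Lemma compact_setU_split K U V : compact K -> open U -> open V ->
  K `<=` U `|` V -> exists C D,
  [/\ compact C, compact D, C `<=` U, D `<=` V & K = C `|` D].
Proof.
move=> cK oU oV KUV.
have [|A [B [oA oB UA VB AB]]] :=
    disjoint_compact_separated (compact_setD cK oU) (compact_setD cK oV).
  by rewrite -subset0 => x [[Kx nUx] [_ nVx]]; case: (KUV x Kx).
exists (K `\` A), (K `\` B); split; [exact: compact_setD..| | |].
- by move=> x [Kx nAx]; apply: contrapT => nUx; apply: nAx; exact: UA.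
- by move=> x [Kx nBx]; apply: contrapT => nVx; apply: nBx; exact: VB.
- by rewrite -setDIr AB setD0.
Qed.

Lemma compact_open_nbhs K : locally_compact [set: X] -> compact K ->
  exists U L, [/\ open U, compact L, K `<=` U & U `<=` L].
Proof.
move=> lcX cK.
pose P A := exists U L, [/\ open U, compact L, A `<=` U & U `<=` L].
apply: (compact_induction (P := P) cK).
- by exists set0, set0; split => //; [exact: open0|exact: compact0].
- move=> A B [U [L [oU cL AU UL]]] [U' [L' [oU' cL' AU' UL']]].
  exists (U `|` U'), (L `|` L').
  by split; [exact: openU|exact: compactU|exact: setUSS|exact: setUSS].
- move=> A B AB [U [L [oU cL BU UL]]]; exists U, L; split => //.
  exact: subset_trans BU.
- move=> x _; have [L xL [cL _]] := lcX x I.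
  have {}xL : nbhs x L by apply: (@filterS _ (nbhs x) _ _ _ _ xL) => z; exact.
  exists L°; split; [exact: open_interior|exact: xL|].
  by exists L°, L; split => //; [exact: open_interior|exact: interior_subset].
Qed.
End topology.

(** * Extended reals and monotone limits along nets *)

Section ereal_bounds.
Context {R : realType}.
Implicit Types (S T : set (\bar R)) (z : \bar R).

(** The nonnegative extended reals admit no subtraction, so bounds on sums of
suprema and infima are checked termwise through this lemma and the next one. *)
Lemma ereal_sup_add_le S T z : S !=set0 -> T !=set0 ->
  (forall x, S x -> 0 <= x) -> (forall y, T y -> 0 <= y) ->
  (forall x y, S x -> T y -> x + y <= z) -> ereal_sup S + ereal_sup T <= z.
Proof.
move=> [x0 Sx0] [y0 Ty0] S0 T0 STz.
have [->|zy] := eqVneq z +oo; first exact: leey.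
have fin x y : S x -> T y -> (x \is a fin_num) /\ (y \is a fin_num).
  move=> Sx Ty; move: (S0 _ Sx) (T0 _ Ty) (STz _ _ Sx Ty) zy.
  by case: x {Sx} => [x||]; case: y {Ty} => [y||]; case: (z) => [w||].
have supS y : T y -> ereal_sup S + y <= z.
  move=> Ty; have [_ yfin] := fin _ _ Sx0 Ty.
  by rewrite -leeBrDr//; apply/ereal_supP => x Sx; rewrite leeBrDr// STz.
have Sfin : ereal_sup S \is a fin_num.
  have := supS _ Ty0; have [_ y0fin] := fin _ _ Sx0 Ty0.
  rewrite ge0_fin_numE; last by apply: le_ereal_sup_tmp; exists x0 => //; exact: S0.
  rewrite -leeBrDr// => /le_lt_trans; apply.
  move: zy y0fin; case: (z) => [r||]; case: (y0) => [t||] //= _ _.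
  by rewrite -?EFinB ltry.
rewrite addeC -leeBrDr//; apply/ereal_supP => y Ty.
by rewrite leeBrDr// addeC supS.
Qed.

Lemma ereal_inf_add_ge S T z :
  (forall x, S x -> 0 <= x) -> (forall y, T y -> 0 <= y) ->
  (forall x y, S x -> T y -> z <= x + y) -> z <= ereal_inf S + ereal_inf T.
Proof.
move=> S0 T0 STz.
have S0' : 0 <= ereal_inf S by apply/ereal_infP.
have T0' : 0 <= ereal_inf T by apply/ereal_infP.
have [Sy|Sy] := eqVneq (ereal_inf S) +oo.
  by rewrite Sy addye ?leey// gt_eqF// (lt_le_trans _ T0')// ltNy0.
have [Ty|Ty] := eqVneq (ereal_inf T) +oo.
  by rewrite Ty addey ?leey// gt_eqF// (lt_le_trans _ S0')// ltNy0.
have Sfin : ereal_inf S \is a fin_num by rewrite ge0_fin_numE// ltey.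
have Tfin : ereal_inf T \is a fin_num by rewrite ge0_fin_numE// ltey.
apply/lee_addgt0Pr => e e0; have e2 : (0 < e / 2)%R by rewrite divr_gt0.
have [x Sx xS] := lb_ereal_inf_adherent e2 Sfin.
have [y Ty' yT] := lb_ereal_inf_adherent e2 Tfin.
apply: le_trans (STz _ _ Sx Ty') _.
rewrite [in leRHS](splitr e) EFinD addeACA.
by apply: leeD; exact: ltW.
Qed.

Lemma ereal_cvg_lt (I : Type) (F : set_system I) (f : I -> \bar R) (l : \bar R) :
  Filter F ->
  (forall a, a < l -> \forall x \near F, a < f x) ->
  (forall a, l < a -> \forall x \near F, f x < a) -> f @ F --> l.
Proof.
move=> FF lbd ubd A.
case: l lbd ubd => [r||] lbd ubd /=.
- move=> [e /= e0 re]; have erE : (r - e < r)%R by rewrite ltrBlDr ltrDl.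
  have : \forall x \near F, (r - e)%:E < f x by apply: lbd; rewrite lte_fin.
  have : \forall x \near F, f x < (r + e)%:E by apply: ubd; rewrite lte_fin ltrDl.
  apply: filterS2 => x; rewrite /=; case: (f x) => [s||]//.
  rewrite !lte_fin => s1 s2; apply: re => /=.
  by rewrite ltr_distlC s1 s2.
- move=> [M [Mr MA]].
  have : \forall x \near F, M%:E < f x by apply: lbd; rewrite ltry.
  by apply: filterS => x; exact: MA.
- move=> [M [Mr MA]].
  have : \forall x \near F, f x < M%:E by apply: ubd; rewrite ltNyr.
  by apply: filterS => x; exact: MA.
Qed.

End ereal_bounds.

Section nets.
Context {R : realType} {X : ptopologicalType}.
Implicit Types (f g : set X -> \bar R) (U F : set X).

Lemma compact_net_proper U : ProperFilter (compact_net U).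
Proof.
apply: filter_from_proper; last by move=> K cK; exists K; split.
apply: filter_from_filter; first by exists set0; split => //; exact: compact0.
move=> K L [cK KU] [cL LU]; exists (K `|` L).
  by split; [exact: compactU|rewrite subUset].
by move=> M [cM]; rewrite subUset => -[KM LM]; split; split.
Qed.

Lemma open_net_proper F : ProperFilter (open_net F).
Proof.
apply: filter_from_proper; last by move=> U oU; exists U; split.
apply: filter_from_filter; first by exists setT; split => //; exact: openT.
move=> U V [oU FU] [oV FV]; exists (U `&` V).
  by split; [exact: openI|rewrite subsetI].
by move=> W [oW]; rewrite subsetI => -[WU WV]; split; split.
Qed.

Lemma compact_net_cvg_sup f U :
  (forall K L, compact K -> compact L -> K `<=` L -> f K <= f L) ->
  f @ compact_net U --> ereal_sup (f @` compact_sub U).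
Proof.
move=> fmono; have PF := compact_net_proper U; apply: ereal_cvg_lt => a.
- move=> /ereal_sup_gtP[_ [K [cK KU] <-] aK]; exists K => // L [[cL LU] KL].
  exact: lt_le_trans aK (fmono _ _ cK cL KL).
- move=> supa; exists set0; first by split => //; exact: compact0.
  move=> K [cK _]; apply: le_lt_trans supa.
  by apply: ereal_sup_ubound; exists K.
Qed.

Lemma open_net_cvg_inf f F :
  (forall U V, open U -> open V -> U `<=` V -> f U <= f V) ->
  f @ open_net F --> ereal_inf (f @` open_sup F).
Proof.
move=> fmono; have PF := open_net_proper F; apply: ereal_cvg_lt => a.
- move=> ainf; exists setT; first by split => //; exact: openT.
  move=> U [oU _]; apply: lt_le_trans ainf _.
  by apply: ereal_inf_lbound; exists U => //; split.
- move=> /ereal_inf_ltP[_ [U [oU FU] <-] Ua]; exists U => // V [[oV FV] VU].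
  exact: le_lt_trans (fmono _ _ oV oU VU) Ua.
Qed.

(** Monotone functions converge to their suprema along the net of compact
subsets, so additivity of the supremum is additivity of limits. *)
Lemma compact_sup_add f g U :
  (forall K L, compact K -> compact L -> K `<=` L -> f K <= f L) ->
  (forall K L, compact K -> compact L -> K `<=` L -> g K <= g L) ->
  ereal_sup (f @` compact_sub U) +? ereal_sup (g @` compact_sub U) ->
  ereal_sup ((f \+ g) @` compact_sub U) =
  ereal_sup (f @` compact_sub U) + ereal_sup (g @` compact_sub U).
Proof.
move=> fmono gmono fg; have ? := compact_net_proper U.
apply: (cvg_unique (@ereal_hausdorff R) (F := (f \+ g)%E @ compact_net U)).
  apply: compact_net_cvg_sup => K L cK cL KL.
  by apply: leeD; [exact: fmono|exact: gmono].
by apply: cvgeD fg _ _; exact: compact_net_cvg_sup.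
Qed.

Lemma open_inf_add f g F :
  (forall U V, open U -> open V -> U `<=` V -> f U <= f V) ->
  (forall U V, open U -> open V -> U `<=` V -> g U <= g V) ->
  ereal_inf (f @` open_sup F) +? ereal_inf (g @` open_sup F) ->
  ereal_inf ((f \+ g) @` open_sup F) =
  ereal_inf (f @` open_sup F) + ereal_inf (g @` open_sup F).
Proof.
move=> fmono gmono fg; have ? := open_net_proper F.
apply: (cvg_unique (@ereal_hausdorff R) (F := (f \+ g)%E @ open_net F)).
  apply: open_net_cvg_inf => U V oU oV UV.
  by apply: leeD; [exact: fmono|exact: gmono].
by apply: cvgeD fg _ _; exact: open_net_cvg_inf.
Qed.

End nets.

(** * From contents on compact sets to Radon measures *)

Section content_measure.
Context {R : realType} {X : ptopologicalType}.
Implicit Types (p : set X -> \bar R) (A B C K U V : set X).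

Record is_content p : Prop := IsContent {
  content_ge0 : forall K, compact K -> 0 <= p K ;
  content_lty : forall K, compact K -> p K < +oo ;
  content_mono : forall K L, compact K -> compact L -> K `<=` L -> p K <= p L ;
  content_subadd : forall K L, compact K -> compact L ->
    p (K `|` L) <= p K + p L ;
  content_superadd : forall K L, compact K -> compact L -> K `&` L = set0 ->
    p K + p L <= p (K `|` L) }.

(** The two-step extension of a function on compact sets, first to open sets and
then to all sets. *)
Definition inner_content p U : \bar R := ereal_sup (p @` compact_sub U).
Definition outer_content p A : \bar R :=
  ereal_inf (inner_content p @` open_sup A).

Hypothesis X_haus : hausdorff_space X.
Variable p : set X -> \bar R.
Hypothesis pc : is_content p.

Local Notation s := (inner_content p).
Local Notation ps := (outer_content p).

Lemma content_set0 : p set0 = 0.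
Proof.
have c0 := @compact0 X; have := content_superadd pc c0 c0 (setI0 _).
have := content_lty pc c0; have := content_ge0 pc c0.
rewrite setU0; case: (p set0) => [r||]//; rewrite !lee_fin => r0 _ rr.
by congr (_%:E); apply/eqP; rewrite eq_le r0 andbT; move: rr; rewrite gerDl.
Qed.

Lemma le_inner_content U V : U `<=` V -> s U <= s V.
Proof.
move=> UV; apply: ereal_sup_le => _ [K [cK KU] <-]; exists K => //.
by split => //; exact: subset_trans UV.
Qed.

Lemma inner_content_ge0 U : 0 <= s U.
Proof.
apply: le_ereal_sup_tmp; exists (p set0); last by rewrite content_set0.
by exists set0 => //; split => //; exact: compact0.
Qed.

Lemma inner_content_set0 : s set0 = 0.
Proof.
apply/eqP; rewrite eq_le inner_content_ge0 andbT; apply/ereal_supP.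
by move=> y [K [_]]; rewrite subset0 => -> <-{y}; rewrite content_set0.
Qed.

Lemma content_le_inner K U : compact K -> K `<=` U -> p K <= s U.
Proof. by move=> cK KU; apply: ereal_sup_ubound; exists K. Qed.

Lemma inner_content_setU U V : open U -> open V -> s (U `|` V) <= s U + s V.
Proof.
move=> oU oV; apply/ereal_supP => _ [K [cK KUV] <-].
have [A [B [cA cB AU BV ->]]] := compact_setU_split X_haus cK oU oV KUV.
apply: le_trans (content_subadd pc cA cB) _.
by apply: leeD; exact: content_le_inner.
Qed.

Lemma inner_content_bigsetU (G : nat -> set X) n : (forall i, open (G i)) ->
  s (\big[setU/set0]_(i < n) G i) <= \sum_(i < n) s (G i).
Proof.
move=> oG; elim: n => [|n IHn]; first by rewrite !big_ord0 inner_content_set0.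
rewrite !big_ord_recr /=; apply: le_trans (inner_content_setU _ (oG n)) _.
  by rewrite -bigcup_mkord; apply: bigcup_open.
exact: leeD.
Qed.

Lemma inner_content_bigcup (G : nat -> set X) : (forall i, open (G i)) ->
  s (\bigcup_i G i) <= \sum_(i <oo) s (G i).
Proof.
move=> oG; apply/ereal_supP => _ [K [cK KG] <-].
have := cK; rewrite compact_cover => /(_ nat setT G)[|//|D _ KD].
  by move=> i _; exact: oG.
(* All the indices of the finite subcover are smaller than [n]. *)
pose n := (\max_(i <- finmap.enum_fset D) i).+1.
have KGn : K `<=` \big[setU/set0]_(i < n) G i.
  move=> x /KD[i iD Gix]; rewrite -bigcup_mkord; exists i => //=.
  by rewrite ltnS; apply: leq_bigmax_seq.
apply: le_trans (content_le_inner cK KGn) _.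
apply: le_trans (inner_content_bigsetU n oG) _.
rewrite -(big_mkord xpredT (fun i => s (G i))).
by apply: nneseries_lim_ge => i _ _; exact: inner_content_ge0.
Qed.

Lemma outer_content_ge0 A : 0 <= ps A.
Proof. by apply/ereal_infP => _ [U _ <-]; exact: inner_content_ge0. Qed.

Lemma le_outer_content A B : A `<=` B -> ps A <= ps B.
Proof.
move=> AB; apply: ereal_inf_le_tmp => _ [U [oU BU] <-]; exists U => //.
by split => //; exact: subset_trans BU.
Qed.

Lemma outer_content_open U : open U -> ps U = s U.
Proof.
move=> oU; apply/eqP; rewrite eq_le; apply/andP; split.
  by apply: ereal_inf_lbound; exists U => //; split.
by apply/ereal_infP => _ [V [_ UV] <-]; exact: le_inner_content.
Qed.

Lemma outer_content_set0 : ps set0 = 0.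
Proof. by rewrite outer_content_open ?inner_content_set0//; exact: open0. Qed.

Lemma outer_content_sigma_subadditive : sigma_subadditive ps.
Proof.
move=> A.
have [[i Ai]|fin] := pselect (exists i, ps (A i) = +oo).
  rewrite (nneseries_pinfty _ _ Ai) ?leey// => n _.
  exact: outer_content_ge0.
have finA i : ps (A i) \is a fin_num.
  rewrite ge0_fin_numE ?outer_content_ge0// ltey.
  by apply/eqP => Ai; apply: fin; exists i.
apply/lee_addgt0Pr => e e0.
(* Open neighborhoods of the [A i] with total excess at most [e]. *)
have /choice[G GP] i : exists G, [/\ open G, A i `<=` G &
    s G <= ps (A i) + (e / (2 ^ i.+1)%:R)%:E].
  have ei : (0 < e / (2 ^ i.+1)%:R)%R by rewrite divr_gt0// ltr0n expn_gt0.
  have [_ [U [oU AU] <-] /ltW Ue] := lb_ereal_inf_adherent ei (finA i).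
  by exists U.
have oG i : open (G i) by have [] := GP i.
apply: le_trans (epsilon_trick _ (fun n => outer_content_ge0 (A n)) (ltW e0)).
apply: (@le_trans _ _ (\sum_(i <oo) s (G i))).
  apply: le_trans (inner_content_bigcup oG).
  rewrite -outer_content_open; last exact: bigcup_open.
  by apply: le_outer_content; apply: subset_bigcup => i _; have [] := GP i.
apply: lee_nneseries => i; first by move=> _ _; exact: inner_content_ge0.
by move=> _; have [] := GP i.
Qed.

(** With [V := U `\` K] this is the superadditivity behind the Caratheodory
measurability of open sets. *)
Lemma content_disjoint_inner K U V : compact K -> open U -> K `<=` U ->
  K `&` V = set0 -> V `<=` U -> p K + s V <= s U.
Proof.
move=> cK oU KU KV VU; rewrite -[p K]ereal_sup1; apply: ereal_sup_add_le.
- by exists (p K).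
- by exists (p set0), set0 => //; split => //; exact: compact0.
- by move=> _ ->; exact: content_ge0.
- by move=> _ [L [cL _] <-]; exact: content_ge0.
move=> _ _ -> [L [cL LV] <-]; apply: le_trans (content_superadd pc cK cL _) _.
  by apply: subsetI_eq0 KV.
apply: content_le_inner; first exact: compactU.
by rewrite subUset; split => //; exact: subset_trans VU.
Qed.

Lemma open_outer_content_caratheodory U A : open U ->
  ps (A `&` U) + ps (A `&` ~` U) <= ps A.
Proof.
move=> oU; apply/ereal_infP => _ [V [oV AV] <-].
apply: (@le_trans _ _ (s (V `&` U) + ps (V `&` ~` U))).
  apply: leeD; last by apply: le_outer_content; exact: setSI.
  rewrite -outer_content_open; last exact: openI.
  by apply: le_outer_content; exact: setSI.
rewrite -[ps _]ereal_sup1; apply: ereal_sup_add_le.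
- by exists (p set0), set0 => //; split => //; exact: compact0.
- by exists (ps (V `&` ~` U)).
- by move=> _ [L [cL _] <-]; exact: content_ge0.
- by move=> _ ->; exact: outer_content_ge0.
move=> _ _ [K [cK KVU] <-] ->.
have oVK : open (V `\` K).
  by apply: openI => //; apply: closed_openC; exact: compact_closed.
apply: (@le_trans _ _ (p K + s (V `\` K))).
  apply: leeD => //; rewrite -outer_content_open//; apply: le_outer_content.
  by move=> x [Vx nUx]; split => // /KVU[].
by apply: content_disjoint_inner => //; [move=> x /KVU[]|rewrite setDIK].
Qed.

(** Caratheodory's construction applied to [outer_content]. The resulting measure
may exceed the content on compact sets, but agrees with the inner content on open
sets, which is what makes it Radon without any [sigma]-compactness of the space. *)
Lemma content_radon : locally_compact [set: X] ->
  exists m : {measure set (borel X) -> \bar R},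
  [/\ is_radon m, (forall U, open U -> m U = s U) &
      (forall K, compact K -> p K <= m K)].
Proof.
move=> lcX.
pose mu : {outer_measure set X -> \bar R} := HB.pack ps
  (isOuterMeasure.Build R X ps outer_content_set0 outer_content_ge0
    le_outer_content outer_content_sigma_subadditive).
have borel_cara : @measurable _ (borel X) `<=` mu.-cara.-measurable.
  apply: smallest_sub; first exact: sigma_algebra_measurable.
  move=> U oU; apply: le_caratheodory_measurable => A.
  exact: open_outer_content_caratheodory.
have sadd : semi_sigma_additive (ps : set (borel X) -> \bar R).
  move=> F mF tF mUF; apply: (@caratheodory_measure_sigma_additive _ _ mu) => //.
  - by move=> i; exact/borel_cara.
  - exact/borel_cara.
pose m : {measure set (borel X) -> \bar R} := HB.pack (ps : set (borel X) -> \bar R)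
  (isMeasure.Build _ (borel X) R (ps : set (borel X) -> \bar R)
    outer_content_set0 outer_content_ge0 sadd).
have mopen U : open U -> m U = s U by exact: outer_content_open.
have mcomp K : compact K -> p K <= m K.
  by move=> cK; apply/ereal_infP => _ [U [oU KU] <-]; exact: content_le_inner.
exists m; split => //; split.
- move=> K cK; have [U [L [oU cL KU UL]]] := compact_open_nbhs lcX cK.
  apply: le_lt_trans (content_lty pc cL).
  apply: (@le_trans _ _ (s U)); first by apply: ereal_inf_lbound; exists U => //; split.
  apply/ereal_supP => _ [C [cC CU] <-]; apply: content_mono => //.
  exact: subset_trans UL.
- move=> A _; rewrite [LHS]/(ps A) /outer_content; congr ereal_inf.
  by apply: eq_imagel => U [oU _]; rewrite mopen.
- move=> U oU; rewrite mopen//; apply/eqP; rewrite eq_le; apply/andP; split.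
    apply/ereal_supP => _ [K [cK KU] <-]; apply: le_ereal_sup_tmp.
    by exists (m K); [exists K|exact: mcomp].
  apply/ereal_supP => _ [K [cK KU] <-]; rewrite -mopen//.
  exact: le_outer_content.
Qed.

End content_measure.

(** * The largest Radon measure below a superadditive set function *)

Section cover_content.
Context {R : realType} {X : ptopologicalType}.
Implicit Types (nu : set X -> \bar R) (A B C K U V : set X).

(** The properties of deficient topological measures and of total variations on
open sets that the construction of a dominated Radon measure relies on. *)
Record is_superadditive nu : Prop := IsSuperadditive {
  superadd_ge0 : forall U, open U -> 0 <= nu U ;
  superadd_mono : forall U V, open U -> open V -> U `<=` V -> nu U <= nu V ;
  superadd_disjoint : forall U V, open U -> open V -> U `&` V = set0 ->
    nu U + nu V <= nu (U `|` V) ;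
  superadd_locfin : forall x, exists U, [/\ open U, U x & nu U < +oo] }.

(** Covers are sequences so that sums over them count repeated members; this makes
concatenation and taking traces on an open set exact on sums. *)
Definition open_cover K : set (seq (set X)) := [set s |
  (forall U, U \in s -> open U) /\ K `<=` \big[setU/set0]_(U <- s) U].

(** The largest subadditive function on compact sets that is dominated by [nu] on
open neighborhoods. *)
Definition cover_content nu K : \bar R :=
  ereal_inf [set \sum_(U <- s) nu U | s in open_cover K].

Lemma open_cover0 : open_cover set0 [::].
Proof. by split=> // U; rewrite in_nil. Qed.

Lemma open_cover1 K U : open U -> K `<=` U -> open_cover K [:: U].
Proof.
move=> oU KU; split; last by rewrite big_seq1.
by move=> V; rewrite mem_seq1 => /eqP ->.
Qed.

Lemma open_coverS K L s : K `<=` L -> open_cover L s -> open_cover K s.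
Proof. by move=> KL [os Ls]; split => //; exact: subset_trans Ls. Qed.

Lemma open_cover_cat K L s t : open_cover K s -> open_cover L t ->
  open_cover (K `|` L) (s ++ t).
Proof.
move=> [os Ks] [ot Lt]; split; last by rewrite big_cat /=; exact: setUSS.
by move=> U; rewrite mem_cat => /orP[/os|/ot].
Qed.

(** Traces of a cover on disjoint neighborhoods of two disjoint compact sets are
covers of each; this is how superadditivity of [nu] is inherited. *)
Lemma open_cover_setI K s V : open V -> K `<=` V -> open_cover K s ->
  open_cover K [seq U `&` V | U <- s].
Proof.
move=> oV KV [os Ks]; split.
  by move=> _ /mapP[U /os oU ->]; exact: openI.
rewrite big_map -(big_morph (setI^~ V) (fun A B => setIUl A B V) (set0I V)).
by rewrite subsetI.
Qed.

Lemma cover_content_ge0 nu K : is_superadditive nu -> 0 <= cover_content nu K.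
Proof.
move=> nus; apply/ereal_infP => _ [s [os _] <-].
by rewrite big_seq; apply: sume_ge0 => U /os; exact: superadd_ge0.
Qed.

Lemma le_cover_content nu K s : open_cover K s ->
  cover_content nu K <= \sum_(U <- s) nu U.
Proof. by move=> sK; apply: ereal_inf_lbound; exists s. Qed.

Lemma cover_content_le_open nu K U : open U -> K `<=` U ->
  cover_content nu K <= nu U.
Proof.
move=> oU KU; have := le_cover_content nu (open_cover1 oU KU).
by rewrite big_seq1.
Qed.

Lemma cover_content_mono nu K L : K `<=` L ->
  cover_content nu K <= cover_content nu L.
Proof.
move=> KL; apply: ereal_inf_le_tmp => _ [s sL <-].
by exists s => //; exact: open_coverS sL.
Qed.

Lemma cover_content_subadd nu K L : is_superadditive nu ->
  cover_content nu (K `|` L) <= cover_content nu K + cover_content nu L.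
Proof.
move=> nus.
have sum_ge0 M z : [set \sum_(U <- s) nu U | s in open_cover M] z -> 0 <= z.
  move=> [s [os _] <-]; rewrite big_seq.
  by apply: sume_ge0 => U /os; exact: superadd_ge0.
apply: ereal_inf_add_ge => [x|y|_ _ [s sK <-] [t tL <-]]; [exact: sum_ge0..|].
by rewrite -big_cat; apply: le_cover_content; exact: open_cover_cat.
Qed.

Hypothesis X_haus : hausdorff_space X.

Lemma cover_content_superadd nu K L : is_superadditive nu ->
  compact K -> compact L -> K `&` L = set0 ->
  cover_content nu K + cover_content nu L <= cover_content nu (K `|` L).
Proof.
move=> nus cK cL KL; apply/ereal_infP => _ [s sKL <-].
have [V [W [oV oW KV LW VW]]] := disjoint_compact_separated X_haus cK cL KL.
have sK := open_cover_setI oV KV (open_coverS (@subsetUl _ K L) sKL).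
have sL := open_cover_setI oW LW (open_coverS (@subsetUr _ K L) sKL).
apply: le_trans (leeD (le_cover_content nu sK) (le_cover_content nu sL)) _.
rewrite !big_map -big_split /= big_seq [leRHS]big_seq; apply: lee_sum => U Us.
have oU : open U by case: sKL => + _; exact.
apply: (le_trans (superadd_disjoint nus (openI oU oV) (openI oU oW) _)).
  by rewrite setIACA VW setI0.
apply: superadd_mono => //; first by apply: openU; exact: openI.
by rewrite subUset; split; exact: subIsetl.
Qed.

Lemma cover_content_lty nu K : is_superadditive nu -> compact K ->
  cover_content nu K < +oo.
Proof.
move=> nus cK; pose P A := cover_content nu A < +oo.
apply: (compact_induction (P := P) cK); rewrite /P.
- by apply: le_lt_trans (le_cover_content nu open_cover0) _; rewrite big_nil.
- move=> A B Afin Bfin; apply: le_lt_trans (cover_content_subadd _ _ nus) _.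
  exact: lte_add_pinfty.
- by move=> A B AB; apply: le_lt_trans; exact: cover_content_mono.
- move=> x _; have [U [oU Ux Ufin]] := superadd_locfin nus x; exists U; split => //.
  exact: le_lt_trans (cover_content_le_open _ oU (@subset_refl _ _)) Ufin.
Qed.

Lemma cover_content_is_content nu : is_superadditive nu ->
  is_content (cover_content nu).
Proof.
move=> nus; split.
- by move=> K _; exact: cover_content_ge0.
- by move=> K; exact: cover_content_lty.
- by move=> K L _ _; exact: cover_content_mono.
- by move=> K L _ _; exact: cover_content_subadd.
- by move=> K L; exact: cover_content_superadd.
Qed.

Hypothesis X_lc : locally_compact [set: X].

(** Every Radon measure below [nu] on open sets is also below
[cover_content nu] on compact sets, by subadditivity; so [m] is the largest one. *)
Lemma max_radon nu : is_superadditive nu ->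
  exists m : {measure set (borel X) -> \bar R},
  [/\ is_radon m, (forall U, open U -> m U <= nu U) &
      (forall K, compact K -> cover_content nu K <= m K)].
Proof.
move=> nus.
have [m [mr mo mK]] :=
  content_radon X_haus (cover_content_is_content nus) X_lc.
exists m; split => // U oU; rewrite mo//; apply/ereal_supP => _ [K [_ KU] <-].
exact: cover_content_le_open.
Qed.

(** Properness without reference to measures: compact sets have finite open covers
of arbitrarily small total [nu]. *)
Definition cover_null nu := forall K, compact K -> cover_content nu K = 0.

(** The largest Radon measure below [nu] dominates [cover_content nu]. *)
Lemma cover_null_of_maximal nu : is_superadditive nu ->
  (forall m : {measure set (borel X) -> \bar R}, is_radon m ->
    (forall U, open U -> m U <= nu U) -> forall K, compact K -> m K = 0) ->
  cover_null nu.
Proof.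
move=> nus nup K cK; have [m [mr mo mK]] := max_radon nus.
apply/eqP; rewrite eq_le cover_content_ge0// andbT.
by rewrite -(nup m mr mo K cK) mK.
Qed.

End cover_content.

(** * Radon measures dominated by superadditive set functions *)

Section radon_domination.
Context {R : realType} {X : ptopologicalType}.
Implicit Types (nu t : set X -> \bar R) (A B C K U V : set X).
Implicit Type m : {measure set (borel X) -> \bar R}.

Lemma open_borel U : open U -> measurable (U : set (borel X)).
Proof. exact: sub_sigma_algebra. Qed.

Lemma closed_borel A : closed A -> measurable (A : set (borel X)).
Proof.
move=> /closed_openC/open_borel mA; rewrite -(setCK A).
exact: (@measurableC _ (borel X)).
Qed.

(** Traces of an open set on disjoint neighborhoods of [K] and [L]. *)
Lemma outer_value_superadd nu K L : hausdorff_space X ->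
  is_superadditive nu -> compact K -> compact L -> K `&` L = set0 ->
  ereal_inf (nu @` open_sup K) + ereal_inf (nu @` open_sup L) <=
  ereal_inf (nu @` open_sup (K `|` L)).
Proof.
move=> X_haus nus cK cL KL; apply/ereal_infP => y [U [oU]].
rewrite subUset => -[KU LU] <-{y}.
have [V [W [oV oW KV LW VW]]] := disjoint_compact_separated X_haus cK cL KL.
have oUV := openI oU oV; have oUW := openI oU oW.
have UVW : (U `&` V) `&` (U `&` W) = set0 by rewrite setIACA VW setI0.
apply: (@le_trans _ _ (nu (U `&` V) + nu (U `&` W))).
  apply: leeD; apply: ereal_inf_lbound.
  - by exists (U `&` V) => //; split => //; rewrite subsetI.
  - by exists (U `&` W) => //; split => //; rewrite subsetI.
apply: le_trans (superadd_disjoint nus oUV oUW UVW) _.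
apply: superadd_mono => //; first exact: openU.
by rewrite subUset; split; exact: subIsetl.
Qed.

Hypothesis X_haus : hausdorff_space X.

Lemma compact_borel K : compact K -> measurable (K : set (borel X)).
Proof. by move=> /(compact_closed X_haus)/closed_borel. Qed.

Lemma radon_compact_fin m K :
  is_radon m -> compact K -> m K \is a fin_num.
Proof.
by move=> mr cK; rewrite ge0_fin_numE ?measure_ge0//; exact: radon_compact.
Qed.

Lemma radon_split m K U : compact K -> open U ->
  m K = m (K `&` U) + m (K `\` U).
Proof.
move=> /compact_borel mK /open_borel mU; rewrite addeC.
exact: (measureDI _ mK mU).
Qed.

(** A Radon measure need not be inner regular on Borel sets, but on a compact
[K] outer regularity at the complement [K `\` U], of finite measure, can be
turned around. *)
Lemma radon_compactI_inner m K U : is_radon m -> compact K -> open U ->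
  m (K `&` U) <= ereal_sup (m @` compact_sub (K `&` U)).
Proof.
move=> mr cK oU; have mK := compact_borel cK; have mU := open_borel oU.
have cKU := compact_setD cK oU.
have KUfin := radon_compact_fin mr cKU.
rewrite -(leeD2rE _ _ KUfin) -radon_split//.
rewrite [in leRHS](radon_outer mr (compact_borel cKU)) addeC.
rewrite -[X in _ + X]ereal_inf1; apply: ereal_inf_add_ge.
- by move=> _ [V _ <-]; exact: measure_ge0.
- move=> _ ->; apply: le_ereal_sup_tmp; exists (m set0); last exact: measure_ge0.
  by exists set0 => //; split => //; exact: compact0.
move=> _ _ [V [oV KUV] <-] ->.
rewrite (radon_split _ cK oV); apply: leeD.
  apply: le_measure; rewrite ?inE; [exact: measurableI (open_borel oV)|exact: open_borel|].
  exact: subIsetr.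
apply: ereal_sup_ubound; exists (K `\` V) => //; split; first exact: compact_setD.
by move=> x [Kx nVx]; split => //; apply: contrapT => nUx; apply: nVx; exact: KUV.
Qed.

(** Induction on the cover: a compact part of [K] inside the first member is
bounded using that member, the compact remainder using the other ones, and the
two values of [t] add up because these parts are disjoint. *)
Lemma radon_le_cover_sum m nu t s K : is_radon m ->
  (forall C, compact C -> 0 <= t C) ->
  (forall C D, compact C -> compact D -> C `<=` D -> t C <= t D) ->
  (forall C D, compact C -> compact D -> C `&` D = set0 ->
    t C + t D <= t (C `|` D)) ->
  (forall C U, compact C -> open U -> C `<=` U -> m C <= nu U + t C) ->
  compact K -> open_cover K s -> m K <= \sum_(U <- s) nu U + t K.
Proof.
move=> mr t0 tmono tadd mnut; elim: s K => [|U s IHs] K cK [os Ks].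
  move: Ks cK; rewrite !big_nil subset0 => -> c0.
  by rewrite measure0 add0e t0.
have oU : open U by apply: os; rewrite mem_head.
have cKU := compact_setD cK oU.
rewrite (radon_split _ cK oU) big_cons.
apply: le_trans (leeD (radon_compactI_inner mr cK oU) (lexx _)) _.
rewrite -[X in _ + X <= _]ereal_sup1; apply: ereal_sup_add_le.
- by exists (m set0), set0 => //; split => //; exact: compact0.
- by exists (m (K `\` U)).
- by move=> y [C _ <-{y}]; exact: measure_ge0.
- by move=> _ ->; exact: measure_ge0.
move=> y z [C [cC]]; rewrite subsetI => -[CK CU] <-{y} ->{z}.
have /(IHs _ cKU) mKU : open_cover (K `\` U) s.
  split; first by move=> V Vs; apply: os; rewrite in_cons Vs orbT.
  by move=> x [Kx nUx]; move: (Ks x Kx); rewrite big_cons => -[].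
apply: le_trans (leeD (mnut _ _ cC oU CU) mKU) _.
rewrite addeACA; apply: leeD => //; apply: (@le_trans _ _ (t (C `|` (K `\` U)))).
  by apply: tadd => //; rewrite -subset0 => x [/CU Ux []].
apply: tmono => //; first exact: compactU.
by rewrite subUset; split => // x [].
Qed.

(** Infimum over all covers of the bound [radon_le_cover_sum]. *)
Lemma radon_le_of_cover_null m nu t K : is_radon m -> is_superadditive nu ->
  cover_null nu ->
  (forall C, compact C -> 0 <= t C) ->
  (forall C D, compact C -> compact D -> C `<=` D -> t C <= t D) ->
  (forall C D, compact C -> compact D -> C `&` D = set0 ->
    t C + t D <= t (C `|` D)) ->
  (forall C U, compact C -> open U -> C `<=` U -> m C <= nu U + t C) ->
  compact K -> m K <= t K.
Proof.
move=> mr nus nud t0 tmono tadd mnut cK.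
rewrite -(add0e (t K)) -(nud K cK) -[t K]ereal_inf1.
apply: ereal_inf_add_ge.
- move=> _ [s [os _] <-]; rewrite big_seq.
  by apply: sume_ge0 => U /os; exact: superadd_ge0.
- by move=> _ ->; exact: t0.
by move=> _ _ [s sK <-] ->; exact: radon_le_cover_sum.
Qed.

Lemma superadditiveD nu1 nu2 : is_superadditive nu1 -> is_superadditive nu2 ->
  is_superadditive (nu1 \+ nu2).
Proof.
move=> s1 s2; split.
- by move=> U oU; apply: adde_ge0; exact: superadd_ge0.
- by move=> U V oU oV UV; apply: leeD; exact: superadd_mono.
- move=> U V oU oV UV; rewrite addeACA.
  by apply: leeD; exact: superadd_disjoint.
- move=> x; have [U [oU Ux Ufin]] := superadd_locfin s1 x.
  have [V [oV Vx Vfin]] := superadd_locfin s2 x.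
  have oUV := openI oU oV; exists (U `&` V); split => //.
  apply: lte_add_pinfty; [apply: le_lt_trans Ufin|apply: le_lt_trans Vfin].
    by apply: superadd_mono => //; exact: subIsetl.
  by apply: superadd_mono => //; exact: subIsetr.
Qed.

Hypothesis X_lc : locally_compact [set: X].

(** A Radon measure below [nu1 + nu2] is below the outer values of [nu2], since
[nu1] is [cover_null], and then below [0], since [nu2] is. *)
Lemma cover_nullD nu1 nu2 : is_superadditive nu1 -> is_superadditive nu2 ->
  cover_null nu1 -> cover_null nu2 -> cover_null (nu1 \+ nu2).
Proof.
move=> s1 s2 d1 d2; apply: cover_null_of_maximal => //; first exact: superadditiveD.
move=> m mr mnu K cK; pose t C := ereal_inf (nu2 @` open_sup C).
have mt C : compact C -> m C <= t C.
  move=> cC; apply: (radon_le_of_cover_null mr s1 d1 _ _ _ _ cC).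
  - by move=> D cD; apply/ereal_infP => _ [V [oV _] <-]; exact: superadd_ge0.
  - move=> D D' cD cD' DD'; apply: ereal_inf_le_tmp => _ [V [oV D'V] <-].
    by exists V => //; split => //; exact: subset_trans D'V.
  - by move=> D D'; exact: outer_value_superadd.
  move=> D U cD oU DU; rewrite -[nu1 U]ereal_inf1; apply: ereal_inf_add_ge.
  - by move=> _ ->; exact: superadd_ge0.
  - by move=> _ [V [oV _] <-]; exact: superadd_ge0.
  move=> _ _ -> [V [oV DV] <-]; have oUV := openI oU oV.
  apply: (@le_trans _ _ (m (U `&` V))).
    apply: le_measure; rewrite ?inE; [exact: compact_borel|exact: open_borel|].
    by rewrite subsetI.
  apply: le_trans (mnu _ oUV) _; apply: leeD.
    by apply: (superadd_mono s1) => //; exact: subIsetl.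
  by apply: (superadd_mono s2) => //; exact: subIsetr.
apply/eqP; rewrite eq_le measure_ge0 andbT.
apply: (radon_le_of_cover_null (t := fun=> 0) mr s2 d2 _ _ _ _ cK) => //.
  by move=> C D _ _ _; rewrite adde0.
move=> C U cC oU CU; rewrite adde0; apply: le_trans (mt C cC) _.
by apply: ereal_inf_lbound; exists U.
Qed.

End radon_domination.

(** * Decomposition of deficient topological measures *)

Section dtm_decomposition.
Context {R : realType} {X : ptopologicalType}.
Hypothesis X_haus : hausdorff_space X.
Implicit Types (nu : set X -> \bar R) (A B C F K L U V : set X).
Implicit Type m : {measure set (borel X) -> \bar R}.

Lemma compact_open_or_closed K : compact K -> open_or_closed K.
Proof. by move=> cK; right; exact: compact_closed. Qed.

Lemma dtm_mono nu A B : is_dtm nu -> open_or_closed A -> open_or_closed B ->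
  A `<=` B -> nu A <= nu B.
Proof.
move=> nud.
have oo U V : open U -> open V -> U `<=` V -> nu U <= nu V.
  move=> oU oV UV; rewrite !(dtm_open nud)//.
  apply: ereal_sup_le => _ [K [cK KU] <-]; exists K => //.
  by split => //; exact: subset_trans UV.
have co F V : closed F -> open V -> F `<=` V -> nu F <= nu V.
  by move=> cF oV FV; rewrite (dtm_closed nud cF); apply: ereal_inf_lbound; exists V.
move=> [oA|cA] [oB|cB] AB; [exact: oo| |exact: co|].
  rewrite (dtm_closed nud cB); apply/ereal_infP => _ [V [oV BV] <-].
  by apply: oo => //; exact: subset_trans BV.
rewrite (dtm_closed nud cB); apply/ereal_infP => _ [V [oV BV] <-].
by apply: co => //; exact: subset_trans BV.
Qed.

Lemma dtm_set0 nu : is_dtm nu -> nu set0 = 0.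
Proof.
move=> nud; have c0 := @compact0 X; have oc0 := compact_open_or_closed c0.
have := dtm_additive nud c0 c0 (setI0 _); rewrite setU0.
have [A ocA nuA] := dtm_nontriv nud.
have := dtm_mono nud oc0 ocA (@sub0set _ A); have := dtm_ge0 nud oc0.
case: (nu set0) => [r||]//= _.
  move=> _ /eqP; rewrite -EFinD eqe -subr_eq0 opprD addNKr oppr_eq0.
  by move=> /eqP ->.
by rewrite leye_eq => /eqP.
Qed.

Lemma dtm_singleton nu x U : is_dtm nu -> open_or_closed U -> U x ->
  nu U < +oo -> `|nu [set x]| < +oo.
Proof.
move=> nud ocU Ux Ufin; have cx := compact_open_or_closed (@compact_set1 X x).
rewrite gee0_abs; last exact: dtm_ge0.
by apply: le_lt_trans Ufin; apply: dtm_mono => // _ ->.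
Qed.

Lemma dtm_superadditive nu : is_dtm nu -> singleton_finite nu ->
  is_superadditive nu.
Proof.
move=> nud nuf; split.
- by move=> U oU; apply: dtm_ge0 => //; left.
- by move=> U V oU oV; apply: dtm_mono => //; left.
- move=> U V oU oV UV; rewrite !(dtm_open nud)//; last exact: openU.
  apply: ereal_sup_add_le.
  + by exists (nu set0), set0 => //; split => //; exact: compact0.
  + by exists (nu set0), set0 => //; split => //; exact: compact0.
  + by move=> _ [K [cK _] <-]; apply: dtm_ge0 => //; exact: compact_open_or_closed.
  + by move=> _ [K [cK _] <-]; apply: dtm_ge0 => //; exact: compact_open_or_closed.
  move=> _ _ [K [cK KU] <-] [L [cL LV] <-].
  rewrite -(dtm_additive nud)//; last exact: subsetI_eq0 UV.
  apply: ereal_sup_ubound; exists (K `|` L) => //.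
  by split; [exact: compactU|exact: setUSS].
- move=> x; have cx : closed [set x] by apply: compact_closed => //; exact: compact_set1.
  have := nuf x; rewrite gee0_abs; last by apply: dtm_ge0 => //; right.
  rewrite (dtm_closed nud cx) => /ereal_inf_ltP[_ [U [oU xU] <-] Ufin].
  by exists U; split => //; exact: xU.
Qed.

Lemma radon_le_compact m nu K : is_dtm nu -> is_radon m ->
  (forall U, open U -> m U <= nu U) -> compact K -> m K <= nu K.
Proof.
move=> nud mr mnu cK; rewrite (dtm_closed nud (compact_closed X_haus cK)).
rewrite (radon_outer mr (compact_borel X_haus cK)).
apply/ereal_infP => _ [U [oU KU] <-]; apply: le_trans (mnu _ oU).
by apply: ereal_inf_lbound; exists U.
Qed.

(** Compact subsets [C] of [L `\` K] satisfy [m C <= nu C], and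
[nu K + nu C <= nu L] by additivity; so [m] grows from [K] to [L] at most as much
as [nu] does. *)
Lemma le_dtm_subr_radon m nu K L : is_dtm nu -> is_radon m ->
  (forall U, open U -> m U <= nu U) -> compact K -> compact L -> K `<=` L ->
  nu K - m K <= nu L - m L.
Proof.
move=> nud mr mnu cK cL KL.
have oK : open (~` K) by apply: closed_openC; exact: compact_closed.
have mfin C : compact C -> m C \is a fin_num by exact: radon_compact_fin.
(* [m L = m K + m (L `\` K)] and [m K] is finite. *)
suff H : nu K + m (L `&` ~` K) <= nu L.
  rewrite leeBrDr ?mfin// (radon_split X_haus m cL oK) setDE setCK.
  rewrite (setIidr KL) [m _ + m K]addeC addeA subeK ?mfin//.
apply: le_trans (leeD (lexx _) (radon_compactI_inner X_haus mr cL oK)) _.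
rewrite -[X in X + _]ereal_sup1; apply: ereal_sup_add_le.
- by exists (nu K).
- by exists (m set0), set0 => //; split => //; exact: compact0.
- by move=> _ ->; apply: dtm_ge0 => //; exact: compact_open_or_closed.
- by move=> _ [C _ <-]; exact: measure_ge0.
move=> _ y -> [C [cC]]; rewrite subsetI => -[CL CK] <-{y}.
apply: le_trans (leeD (lexx _) (radon_le_compact nud mr mnu cC)) _.
rewrite -(dtm_additive nud)//; last by rewrite -subset0 => x [Kx /CK].
apply: dtm_mono => //; [|exact: compact_open_or_closed|by rewrite subUset].
by apply: compact_open_or_closed; exact: compactU.
Qed.

(** The function [nu - m] makes sense on compact sets, where [m] is finite. It is
extended to open and then to all sets by inner and outer approximation, and the
relation [nu = m + nu'] survives as a sum of monotone limits. *)
Lemma dtm_subr_radon m nu : is_dtm nu -> is_radon m ->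
  (forall U, open U -> m U <= nu U) ->
  exists2 nu', is_dtm nu' & is_sum_oc nu m nu'.
Proof.
move=> nud mr mnu; pose g K := nu K - m K.
have mfin C : compact C -> m C \is a fin_num by exact: radon_compact_fin.
have gmono K L : compact K -> compact L -> K `<=` L -> g K <= g L.
  exact: le_dtm_subr_radon.
have g0 K : compact K -> 0 <= g K.
  by move=> cK; rewrite /g sube_ge0 ?mfin//; exact: radon_le_compact.
have mmono (U V : set X) : measurable (U : set (borel X)) ->
    measurable (V : set (borel X)) -> U `<=` V -> m U <= m V.
  by move=> mU mV UV; apply: le_measure; rewrite ?inE.
pose nu' := outer_content g.
have nu'o U : open U -> nu' U = inner_content g U by exact: outer_content_open.
have inner0 U : 0 <= inner_content g U.
  apply: le_ereal_sup_tmp; exists (g set0); last by apply: g0; exact: compact0.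
  by exists set0 => //; split => //; exact: compact0.
have nu'0 A : 0 <= nu' A by apply/ereal_infP => _ [U _ <-].
have sumo U : open U -> nu U = m U + nu' U.
  move=> oU; rewrite nu'o// (radon_inner mr oU) -compact_sup_add.
  - rewrite (dtm_open nud oU); congr ereal_sup; apply: eq_imagel => K [cK _].
    by rewrite /g addeC subeK ?mfin.
  - by move=> K L cK cL; apply: mmono; exact: compact_borel.
  - exact: gmono.
  by rewrite -(radon_inner mr oU) ge0_adde_def ?inE ?measure_ge0//; exact: inner0.
have sumc F : closed F -> nu F = m F + nu' F.
  move=> cF; rewrite (radon_outer mr (closed_borel cF)).
  rewrite -open_inf_add.
  - rewrite (dtm_closed nud cF); congr ereal_inf; apply: eq_imagel => U [oU _].
    by rewrite sumo// nu'o.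
  - by move=> U V oU oV; apply: mmono; exact: open_borel.
  - by move=> U V _ _; exact: le_inner_content.
  by rewrite -(radon_outer mr (closed_borel cF)) ge0_adde_def ?inE ?measure_ge0//; exact: nu'0.
have sum A : open_or_closed A -> nu A = m A + nu' A by move=> [/sumo|/sumc].
have nu'K K : compact K -> nu' K = g K.
  move=> cK; rewrite /g (sumc _ (compact_closed X_haus cK)).
  by rewrite [m K + _]addeC addeK ?mfin.
exists nu'; last by move=> A /sum ?; split => //; rewrite ge0_adde_def ?inE ?measure_ge0.
split.
- by move=> A _; exact: nu'0.
- have [A ocA nuA] := dtm_nontriv nud; exists A => // nu'A; apply: nuA.
  by rewrite sum// nu'A addey// gt_eqF// (lt_le_trans _ (measure_ge0 m A))// ltNy0.
- move=> C K cC cK CK; have mC := mfin _ cC; have mK := mfin _ cK.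
  rewrite !nu'K//; last exact: compactU.
  rewrite /g (dtm_additive nud)//.
  rewrite (measureU m (compact_borel X_haus cC) (compact_borel X_haus cK) CK).
  by rewrite fin_num_oppeD// addeACA.
- move=> U oU; rewrite nu'o//; congr ereal_sup.
  by apply: eq_imagel => K [cK _]; rewrite nu'K.
- move=> F cF; congr ereal_inf.
  by apply: eq_imagel => U [oU _]; rewrite nu'o.
Qed.

Lemma radon_le_sum m s K : compact K -> open_cover K s ->
  m K <= \sum_(U <- s) m U.
Proof.
move=> cK [os Ks]; have mK := compact_borel X_haus cK.
elim: s K mK os Ks {cK} => [|U s IHs] K mK os.
  by rewrite !big_nil subset0 => ->; rewrite measure0.
have oU : open U by apply: os; rewrite mem_head.
rewrite !big_cons => Ks; rewrite (measureDI m mK (open_borel oU)) addeC.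
have mKU : measurable (K `\` U : set (borel X)).
  by apply: measurableD => //; exact: open_borel.
apply: leeD.
  apply: le_measure; rewrite ?inE; last exact: subIsetr.
    by apply: measurableI => //; exact: open_borel.
  exact: open_borel.
apply: IHs => //; first by move=> V Vs; apply: os; rewrite in_cons Vs orbT.
by move=> x [/Ks[]].
Qed.

Hypothesis X_lc : locally_compact [set: X].

(** Singletons of finite value make [nu] locally finite, so the largest Radon
measure [m] below it exists. Covers give
[m K + cover_content nu' K <= cover_content nu K <= m K]. *)
Lemma dtm_decomposition nu : is_dtm nu -> singleton_finite nu ->
  exists m nu', [/\ is_radon m, is_dtm nu', is_sum_oc nu m nu',
    singleton_finite nu' & cover_null nu'].
Proof.
move=> nud nuf; have nus := dtm_superadditive nud nuf.
have [m [mr mnu pm]] := max_radon X_haus X_lc nus.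
have [nu' nu'd sum] := dtm_subr_radon nud mr mnu.
have nu'f : singleton_finite nu'.
  move=> x; have [U [oU Ux Ufin]] := superadd_locfin nus x.
  have ocU : open_or_closed U by left.
  apply: (dtm_singleton nu'd ocU Ux); apply: le_lt_trans Ufin.
  by have [_ ->] := sum U ocU; apply: lee_paddl => //; exact: measure_ge0.
have nu's := dtm_superadditive nu'd nu'f.
exists m, nu'; split => // K cK.
have mfin := radon_compact_fin mr cK.
apply/eqP; rewrite eq_le cover_content_ge0// andbT.
rewrite -(leeD2lE _ _ mfin) adde0; apply: le_trans (pm _ cK).
apply/ereal_infP => _ [s sK <-].
apply: le_trans (leeD (radon_le_sum m cK sK) (le_cover_content nu' sK)) _.
rewrite -big_split /= big_seq [leRHS]big_seq; apply: lee_sum => U Us.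
have ocU : open_or_closed U by left; case: sK => + _; exact.
by have [_ ->] := sum U ocU.
Qed.

End dtm_decomposition.

(** * Total variation *)

Section variation.
Context {R : realType} {X : ptopologicalType}.
Implicit Types (nu lam : set X -> \bar R) (A B C F K L U V : set X).
Implicit Type m : {measure set (borel X) -> \bar R}.

Lemma additive_compact_bigsetU nu n (K : 'I_n -> set X) (P : pred 'I_n) :
  additive_compact nu -> nu set0 = 0 -> (forall i, compact (K i)) ->
  trivIset [set: 'I_n] K ->
  nu (\big[setU/set0]_(i < n | P i) K i) = \sum_(i < n | P i) nu (K i).
Proof.
move=> nua nu0 cK tK; rewrite -big_filter -[RHS]big_filter.
have : uniq [seq i <- index_enum 'I_n | P i].
  by rewrite filter_uniq// index_enum_uniq.
elim: [seq i <- _ | P i] => [|i r IHr] /=; first by rewrite !big_nil.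
move=> /andP[ir ur]; rewrite !big_cons nua ?IHr//.
  by apply: bigsetU_compact => j _; exact: cK.
rewrite -subset0 -bigcup_seq => x [Kix [j /= jr Kjx]].
have ij : i = j by apply: tK => //; exists x.
by move: ir; rewrite ij jr.
Qed.

Lemma variation_family0 nu U : exists (n : nat) (K : 'I_n -> set X),
  [/\ forall i, compact (K i), trivIset [set: 'I_n] K,
      \bigcup_i K i `<=` U & 0 = \sum_(i < n) `|nu (K i)|].
Proof.
exists 0%N, (fun=> set0); split => //.
- by move=> i; exact: compact0.
- by move=> [].
- by move=> x [[]].
- by rewrite big_ord0.
Qed.

Lemma sf_variation_open_ge0 nu U : 0 <= sf_variation_open nu U.
Proof. by apply: ereal_sup_ubound; exact: variation_family0. Qed.

Lemma le_sf_variation_open nu K U : compact K -> K `<=` U ->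
  `|nu K| <= sf_variation_open nu U.
Proof.
move=> cK KU; apply: ereal_sup_ubound; exists 1%N, (fun=> K); split => //.
- by move=> i j _ _ _; rewrite !ord1.
- by move=> x [_ _]; exact: KU.
- by rewrite big_ord1.
Qed.

Lemma sf_variation_open_mono nu U V : U `<=` V ->
  sf_variation_open nu U <= sf_variation_open nu V.
Proof.
move=> UV; apply: ereal_sup_le => _ [n [K [cK tK KU ->]]].
by exists n, K; split => //; exact: subset_trans UV.
Qed.

Lemma sf_variation_open_superadd nu U V : U `&` V = set0 ->
  sf_variation_open nu U + sf_variation_open nu V <=
  sf_variation_open nu (U `|` V).
Proof.
move=> UV; apply: ereal_sup_add_le.
- by exists 0; exact: variation_family0.
- by exists 0; exact: variation_family0.
- by move=> _ [n [K [_ _ _ ->]]]; exact: sume_ge0.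
- by move=> _ [n [K [_ _ _ ->]]]; exact: sume_ge0.
move=> _ _ [n [K [cK tK KU ->]]] [k [L [cL tL LV ->]]].
pose M (i : 'I_(n + k)) :=
  match fintype.split i with inl j => K j | inr j => L j end.
have KLdisj i j x : K i x -> L j x -> False.
  move=> Kx Lx; have : (U `&` V) x.
    by split; [apply: KU; exists i|apply: LV; exists j].
  by rewrite UV.
apply: ereal_sup_ubound; exists (n + k)%N, M; split.
- by move=> i; rewrite /M; case: fintype.split.
- move=> i j _ _ [x []]; rewrite /M.
  case: split_ordP => i' ->; case: split_ordP => j' -> //.
  + by move=> Kx Kx'; congr lshift; apply: tK => //; exists x.
  + by move=> Kx Lx; case: (KLdisj _ _ _ Kx Lx).
  + by move=> Lx Kx; case: (KLdisj _ _ _ Kx Lx).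
  + by move=> Kx Kx'; congr rshift; apply: tL => //; exists x.
- move=> x [i _]; rewrite /M; case: fintype.split => j Mx.
    by left; apply: KU; exists j.
  by right; apply: LV; exists j.
- rewrite big_split_ord /=; congr (_ + _); apply: eq_bigr => i _.
    by rewrite /M (unsplitK (inl _ i)).
  by rewrite /M (unsplitK (inr _ i)).
Qed.

Lemma le_sf_norm nu K : compact K -> `|nu K| <= sf_norm nu.
Proof. by move=> cK; apply: ereal_sup_ubound; exists K. Qed.

Lemma sf_norm_fin nu K : sf_norm nu < +oo -> compact K -> nu K \is a fin_num.
Proof.
move=> nuf cK; rewrite fin_num_abs; exact: le_lt_trans (le_sf_norm nu cK) nuf.
Qed.

(** Group the members of a disjoint family by the sign of their values; each
group has a union whose value is bounded by the norm. *)
Lemma sf_variation_open_le_norm nu U : additive_compact nu ->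
  sf_norm nu < +oo -> sf_variation_open nu U <= sf_norm nu + sf_norm nu.
Proof.
move=> nua nuf; apply/ereal_supP => _ [n [K [cK tK _ ->]]].
have nu0 : nu set0 = 0.
  have c0 := @compact0 X; have := nua _ _ c0 c0 (setI0 _); rewrite setU0.
  have := sf_norm_fin nuf c0; case: (nu set0) => [r||]// _.
  by move=> /eqP; rewrite -EFinD eqe -subr_eq0 opprD addNKr oppr_eq0 => /eqP ->.
have cU (P : pred 'I_n) : compact (\big[setU/set0]_(i < n | P i) K i).
  by apply: bigsetU_compact => i _.
rewrite (bigID (fun i => 0 <= nu (K i))) /=; apply: leeD.
  rewrite (eq_bigr (fun i => nu (K i))); last by move=> i /gee0_abs.
  rewrite -additive_compact_bigsetU//; apply: le_trans (le_sf_norm nu (cU _)).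
  exact: lee_abs.
rewrite (eq_bigr (fun i => - nu (K i))); last first.
  by move=> i; rewrite -ltNge => /lte0_abs.
rewrite sumeN; last first.
  by move=> i j _ _; apply: fin_num_adde_defl; exact: sf_norm_fin.
rewrite -additive_compact_bigsetU//; apply: le_trans (le_sf_norm nu (cU _)).
by rewrite -(abseN (nu _)); exact: lee_abs.
Qed.

Lemma sf_variation_superadditive nu : additive_compact nu ->
  sf_norm nu < +oo -> is_superadditive (sf_variation_open nu).
Proof.
move=> nua nuf; split.
- by move=> U _; exact: sf_variation_open_ge0.
- by move=> U V _ _; exact: sf_variation_open_mono.
- by move=> U V _ _; exact: sf_variation_open_superadd.
- move=> x; exists setT; split => //; first exact: openT.
  apply: le_lt_trans (sf_variation_open_le_norm _ nua nuf) _.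
  exact: lte_add_pinfty.
Qed.

Lemma sf_variation_openE nu U : open U ->
  sf_variation nu U = sf_variation_open nu U.
Proof. by move=> oU; rewrite /sf_variation asboolT. Qed.

(** The variation of an additive function of finite norm is superadditive on
open sets, and properness says that no nonzero Radon measure lies below it. *)
Lemma proper_variation_cover_null nu : hausdorff_space X ->
  locally_compact [set: X] -> additive_compact nu -> sf_norm nu < +oo ->
  is_proper nu -> cover_null (sf_variation_open nu).
Proof.
move=> X_haus X_lc nua nuf nup; apply: cover_null_of_maximal => //.
  exact: sf_variation_superadditive.
move=> m mr mnu K cK; apply: (nup m mr); last exact: compact_open_or_closed.
move=> A ocA; rewrite /sf_variation; case: asboolP => [/mnu//|nA].
case: ocA => // cA; rewrite (radon_outer mr (closed_borel cA)).
apply/ereal_infP => _ [U [oU AU] <-]; apply: le_trans (mnu _ oU).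
by apply: ereal_inf_lbound; exists U.
Qed.

Lemma sf_variation_open_diff_le lam nu1 nu2 U : hausdorff_space X ->
  is_dtm nu1 -> is_dtm nu2 -> is_diff_oc lam nu1 nu2 -> open U ->
  sf_variation_open lam U <= nu1 U + nu2 U.
Proof.
move=> X_haus d1 d2 lamE oU; apply/ereal_supP => _ [n [K [cK tK KU ->]]].
have ocK i := compact_open_or_closed X_haus (cK i).
have ocU : open_or_closed U by left.
apply: (@le_trans _ _ (\sum_(i < n) (nu1 (K i) + nu2 (K i)))).
  apply: lee_sum => i _; have [_ ->] := lamE _ (ocK i).
  apply: le_trans (lee_abs_sub _ _) _.
  by rewrite !gee0_abs//; apply: dtm_ge0.
have bound nu : is_dtm nu -> \sum_(i < n) nu (K i) <= nu U.
  move=> nud; rewrite -additive_compact_bigsetU//.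
  - apply: dtm_mono => //; last first.
      by rewrite -bigcup_seq => x [i _ Kix]; apply: KU; exists i.
    by apply: compact_open_or_closed => //; apply: bigsetU_compact => i _.
  - exact: dtm_additive.
  - exact: dtm_set0.
by rewrite big_split /=; apply: leeD; exact: bound.
Qed.

End variation.

(** * Differences of deficient topological measures *)

Section signed_dtm.
Context {R : realType} {X : ptopologicalType}.
Hypothesis X_haus : hausdorff_space X.
Implicit Types (nu lam : set X -> \bar R) (A B C F K L U V : set X).
Implicit Type m : {measure set (borel X) -> \bar R}.

Lemma open_or_closedT : open_or_closed [set: X].
Proof. by left; exact: openT. Qed.

Lemma dtm_fin_num nu A : is_dtm nu -> sf_finite nu -> open_or_closed A ->
  nu A \is a fin_num.
Proof.
move=> nud nuf ocA; rewrite ge0_fin_numE; last exact: dtm_ge0.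
by apply: le_lt_trans nuf; apply: dtm_mono => //; exact: open_or_closedT.
Qed.

Lemma open_or_closed_borel A : open_or_closed A -> measurable (A : set (borel X)).
Proof. by move=> [/open_borel|/closed_borel]. Qed.

Lemma measure_fin_num m A : sf_finite (m : set X -> \bar R) ->
  measurable (A : set (borel X)) -> m A \is a fin_num.
Proof.
move=> mf mA; rewrite ge0_fin_numE ?measure_ge0//.
by apply: le_lt_trans mf; apply: le_measure; rewrite ?inE.
Qed.

(** Finiteness of one of the two functions makes all differences meaningful,
and monotone limits along the two nets can then be subtracted. *)
Lemma signed_dtm_diff nu1 nu2 : is_dtm nu1 -> is_dtm nu2 ->
  sf_finite nu1 \/ sf_finite nu2 ->
  is_diff_oc (nu1 \- nu2) nu1 nu2 /\ is_signed_dtm (nu1 \- nu2).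
Proof.
move=> d1 d2 fin.
have dif A : open_or_closed A -> nu1 A +? - nu2 A.
  move=> ocA; case: fin => f.
    by apply: fin_num_adde_defr; exact: dtm_fin_num.
  by apply: fin_num_adde_defl; rewrite fin_numN; exact: dtm_fin_num.
have oc0 : open_or_closed (@set0 X) by left; exact: open0.
have d0 : nu1 set0 - nu2 set0 = 0 by rewrite !(dtm_set0 X_haus) // sube0.
split; first by move=> A ocA; split => //; exact: dif.
split.
- case: fin => f; [left|right] => A ocA.
    have := dtm_fin_num d1 f ocA; have := dtm_ge0 d2 ocA.
    by case: (nu1 A) (nu2 A) => [r||] [t||].
  have := dtm_fin_num d2 f ocA; have := dtm_ge0 d1 ocA.
  by case: (nu1 A) (nu2 A) => [r||] [t||].
- by exists set0; rewrite //= d0.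
- by exists set0; rewrite //= d0.
- move=> C K cC cK CK; rewrite (dtm_additive d1)// (dtm_additive d2)//.
  have ocC := compact_open_or_closed X_haus cC.
  have ocK := compact_open_or_closed X_haus cK.
  have := dtm_ge0 d1 ocC; have := dtm_ge0 d1 ocK.
  have := dtm_ge0 d2 ocC; have := dtm_ge0 d2 ocK.
  case: fin => f.
    have := dtm_fin_num d1 f ocC; have := dtm_fin_num d1 f ocK.
    case: (nu1 C) (nu1 K) => [r||] [t||]// _ _.
    case: (nu2 C) (nu2 K) => [u||] [v||]// _ _ _ _.
    by rewrite -!(EFinD, EFinN, EFinB); congr EFin; rewrite opprD addrACA.
  have c2 := dtm_fin_num d2 f ocC; have k2 := dtm_fin_num d2 f ocK.
  by move=> _ _ _ _; rewrite fin_num_oppeD// addeACA.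
- move=> U oU; have PF := compact_net_proper U.
  have cvg nu : is_dtm nu -> nu @ compact_net U --> nu U.
    move=> nud; rewrite [X in _ --> X](dtm_open nud oU).
    apply: compact_net_cvg_sup => K L cK cL.
    by apply: dtm_mono => //; exact: compact_open_or_closed.
  by apply: cvgeB; [apply: dif; left|exact: cvg..].
- move=> F cF; have PF := open_net_proper F.
  have cvg nu : is_dtm nu -> nu @ open_net F --> nu F.
    move=> nud; rewrite [X in _ --> X](dtm_closed nud cF).
    by apply: open_net_cvg_inf => U V oU oV; apply: dtm_mono => //; left.
  by apply: cvgeB; [apply: dif; right|exact: cvg..].
Qed.

Lemma radon_null_oc m : is_radon m -> (forall K, compact K -> m K = 0) ->
  eq_oc m (fun=> 0).
Proof.
move=> mr m0 A ocA; apply/eqP; rewrite eq_le measure_ge0 andbT.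
have <- : m [set: X] = 0.
  apply/eqP; rewrite eq_le measure_ge0 andbT (radon_inner mr openT).
  by apply/ereal_supP => _ [K [cK _] <-]; rewrite m0.
apply: le_measure; rewrite ?inE//; exact: open_or_closed_borel.
Qed.

Lemma radon_eq_oc m1 m2 : is_radon m1 -> is_radon m2 ->
  (forall K, compact K -> m1 K = m2 K) -> eq_oc m1 m2.
Proof.
move=> r1 r2 m12.
have m12o U : open U -> m1 U = m2 U.
  move=> oU; rewrite (radon_inner r1 oU) (radon_inner r2 oU); congr ereal_sup.
  by apply: eq_imagel => K [/m12].
move=> A [/m12o//|cA]; have mA := closed_borel cA.
rewrite (radon_outer r1 mA) (radon_outer r2 mA); congr ereal_inf.
by apply: eq_imagel => U [/m12o].
Qed.

Lemma radonD m1 m2 : is_radon m1 -> is_radon m2 ->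
  exists2 m : {measure set (borel X) -> \bar R},
    is_radon m & forall A, m A = m1 A + m2 A.
Proof.
move=> r1 r2.
have [m12 mE] : exists m : {measure set (borel X) -> \bar R},
    forall A, m A = m1 A + m2 A.
  by exists (measure_add m1 m2) => A; exact: measure_addE.
exists m12 => //.
have mono m K L : measurable (K : set (borel X)) ->
    measurable (L : set (borel X)) -> K `<=` L -> m K <= m L.
  by move=> mK mL KL; apply: le_measure; rewrite ?inE.
split.
- by move=> K cK; rewrite mE; apply: lte_add_pinfty; exact: radon_compact.
- move=> A mA; rewrite mE (radon_outer r1 mA) (radon_outer r2 mA) -open_inf_add.
  + by congr ereal_inf; apply: eq_imagel => U _; rewrite mE.
  + by move=> U V oU oV; apply: mono; exact: open_borel.
  + by move=> U V oU oV; apply: mono; exact: open_borel.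
  by rewrite -(radon_outer r1 mA) -(radon_outer r2 mA) ge0_adde_def ?inE ?measure_ge0.
- move=> U oU; rewrite mE (radon_inner r1 oU) (radon_inner r2 oU) -compact_sup_add.
  + by congr ereal_sup; apply: eq_imagel => K _; rewrite mE.
  + by move=> K L cK cL; apply: mono; exact: compact_borel.
  + by move=> K L cK cL; apply: mono; exact: compact_borel.
  by rewrite -(radon_inner r1 oU) -(radon_inner r2 oU) ge0_adde_def ?inE ?measure_ge0.
Qed.

Lemma radon_finite_of_bound m : is_radon m ->
  (exists2 c, c < +oo & forall K, compact K -> m K <= c) ->
  sf_finite (m : set X -> \bar R).
Proof.
move=> mr [c cy mc]; rewrite /sf_finite (radon_inner mr openT).
by apply: le_lt_trans cy; apply/ereal_supP => _ [K [cK _] <-]; exact: mc.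
Qed.

Hypothesis X_lc : locally_compact [set: X].

(** The variation of the difference is at most the sum, which is
[cover_null]. *)
Lemma diff_cover_null_proper nu1 nu2 : is_dtm nu1 -> is_dtm nu2 ->
  singleton_finite nu1 -> singleton_finite nu2 ->
  sf_finite nu1 \/ sf_finite nu2 ->
  cover_null nu1 -> cover_null nu2 -> is_proper (nu1 \- nu2).
Proof.
move=> d1 d2 s1 s2 fin n1 n2 m mr mv.
have [dif _] := signed_dtm_diff d1 d2 fin.
have S1 := dtm_superadditive X_haus d1 s1.
have S2 := dtm_superadditive X_haus d2 s2.
apply: radon_null_oc => // K cK; apply/eqP; rewrite eq_le measure_ge0 andbT.
apply: (radon_le_of_cover_null (t := fun=> 0) X_haus mr (superadditiveD S1 S2)
  (cover_nullD X_haus X_lc S1 S2 n1 n2) _ _ _ _ cK) => //.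
  by move=> C D _ _ _; rewrite adde0.
move=> C U cC oU CU; rewrite adde0.
apply: (@le_trans _ _ (m U)).
  by apply: le_measure; rewrite ?inE; [exact: compact_borel|exact: open_borel|].
have ocU : open_or_closed U by left.
apply: le_trans (mv _ ocU) _; rewrite sf_variation_openE//.
exact: sf_variation_open_diff_le.
Qed.

Lemma signed_dtm_decomposition mu1 mu2 mu : is_dtm mu1 -> is_dtm mu2 ->
  singleton_finite mu1 -> singleton_finite mu2 ->
  sf_finite mu1 \/ sf_finite mu2 -> is_diff_oc mu mu1 mu2 ->
  exists (m1 m2 : {measure set (borel X) -> \bar R}) mu',
  [/\ [/\ is_radon m1, is_radon m2,
        sf_finite (m1 : set X -> \bar R) \/ sf_finite (m2 : set X -> \bar R)
        & is_diff_oc (fun A => m1 A - m2 A) m1 m2],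
      is_sum_oc mu (fun A => m1 A - m2 A) mu',
      [/\ is_signed_dtm mu', singleton_finite mu' & is_proper mu'] &
      sf_finite mu1 -> sf_finite mu2 ->
        [/\ sf_finite (m1 : set X -> \bar R), sf_finite (m2 : set X -> \bar R)
          & sf_norm mu' < +oo]].
Proof.
move=> d1 d2 s1 s2 fin muE.
have [m1 [nu1 [r1 dn1 sum1 sn1 n1]]] := dtm_decomposition X_haus X_lc d1 s1.
have [m2 [nu2 [r2 dn2 sum2 sn2 n2]]] := dtm_decomposition X_haus X_lc d2 s2.
have ocT := open_or_closedT.
have finite m mu' nu : is_sum_oc mu' m nu -> is_dtm nu -> sf_finite mu' ->
    sf_finite (m : set X -> \bar R) /\ sf_finite nu.
  move=> sum nud; rewrite /sf_finite; have [_ ->] := sum _ ocT => sf.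
  split; apply: le_lt_trans sf.
    by rewrite leeDl//; exact: dtm_ge0.
  by rewrite leeDr.
have fin1 := finite _ _ _ sum1 dn1; have fin2 := finite _ _ _ sum2 dn2.
have finm : sf_finite (m1 : set X -> \bar R) \/ sf_finite (m2 : set X -> \bar R).
  by case: fin => [/fin1[]|/fin2[]]; [left|right].
have finn : sf_finite nu1 \/ sf_finite nu2.
  by case: fin => [/fin1[]|/fin2[]]; [left|right].
have [_ sd] := signed_dtm_diff dn1 dn2 finn.
exists m1, m2, (nu1 \- nu2); split => //.
- split => // A /open_or_closed_borel mA; split => //; case: finm => f.
    by apply: fin_num_adde_defr; exact: measure_fin_num.
  by apply: fin_num_adde_defl; rewrite fin_numN; exact: measure_fin_num.
- move=> A ocA; have mA := open_or_closed_borel ocA.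
  have [_ ->] := muE A ocA; have [_ ->] := sum1 A ocA; have [_ ->] := sum2 A ocA.
  have := measure_ge0 m1 A; have := measure_ge0 m2 A.
  have := dtm_ge0 dn1 ocA; have := dtm_ge0 dn2 ocA; rewrite /=.
  case: fin => [/fin1|/fin2] [f g].
    have := measure_fin_num f mA; have := dtm_fin_num dn1 g ocA.
    case: (m1 A) (nu1 A) => [a||] [b||]// _ _.
    case: (m2 A) (nu2 A) => [c||] [e||]// _ _ _ _; split => //.
    by rewrite -!(EFinD, EFinN, EFinB); congr EFin; rewrite opprD addrACA.
  have := measure_fin_num f mA; have := dtm_fin_num dn2 g ocA.
  case: (m2 A) (nu2 A) => [a||] [b||]// _ _.
  case: (m1 A) (nu1 A) => [c||] [e||]// _ _ _ _; split => //.
  by rewrite -!(EFinD, EFinN, EFinB); congr EFin; rewrite opprD addrACA.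

- split => //; last exact: diff_cover_null_proper.
  move=> x; apply: le_lt_trans (lee_abs_sub _ _) _.
  by apply: lte_add_pinfty.
- move=> /fin1[f1 g1] /fin2[f2 g2]; split => //.
  apply: (@le_lt_trans _ _ (nu1 setT + nu2 setT)); last exact: lte_add_pinfty.
  apply/ereal_supP => _ [K cK <-]; apply: le_trans (lee_abs_sub _ _) _.
  have ocK := compact_open_or_closed X_haus cK.
  by rewrite !gee0_abs ?dtm_ge0//; apply: leeD; apply: dtm_mono.
Qed.

End signed_dtm.

(** * Uniqueness *)

Section uniqueness.
Context {R : realType} {X : ptopologicalType}.
Hypothesis X_haus : hausdorff_space X.
Implicit Types (nu lam : set X -> \bar R) (A B C F K L U V : set X).

(** If one part of a signed Radon measure is finite and the difference is
bounded, the other part is bounded on compact sets, hence finite. *)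
Lemma signed_radon_finite lam : is_signed_radon lam -> sf_norm lam < +oo ->
  exists m1 m2 : {measure set (borel X) -> \bar R},
  [/\ is_radon m1, is_radon m2, sf_finite (m1 : set X -> \bar R),
      sf_finite (m2 : set X -> \bar R) & is_diff_oc lam m1 m2].
Proof.
move=> [m1 [m2 [r1 r2 fin lamE]]] lamf; exists m1, m2.
have le_lam (m m' : {measure set (borel X) -> \bar R}) :
    is_radon m -> is_radon m' -> sf_finite (m' : set X -> \bar R) ->
    (forall K, compact K -> m K <= m' K + `|lam K|) ->
    sf_finite (m : set X -> \bar R).
  move=> mr mr' fin' mm'.
  apply: (radon_finite_of_bound mr); exists (m' setT + sf_norm lam).
    exact: lte_add_pinfty.
  move=> K cK; apply: le_trans (mm' K cK) _; apply: leeD; last exact: le_sf_norm.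
  apply: le_measure; rewrite ?inE//; exact: compact_borel.
have lamK K : compact K -> lam K = m1 K - m2 K.
  by move=> cK; have [_ ->] := lamE K (compact_open_or_closed X_haus cK).
have m12 K : compact K -> m1 K <= m2 K + `|lam K|.
  move=> cK; rewrite (lamK K cK) -leeBlDl ?radon_compact_fin//.
  exact: lee_abs.
have m21 K : compact K -> m2 K <= m1 K + `|lam K|.
  move=> cK; rewrite (lamK K cK) -leeBlDl ?radon_compact_fin//.
  rewrite -abseN fin_num_oppeB ?radon_compact_fin// addeC; exact: lee_abs.
case: fin => f; split => //.
  exact: le_lam f m21.
exact: le_lam f m12.
Qed.

Hypothesis X_lc : locally_compact [set: X].

(** On compact sets [m1 <= m2 + |lam| + |nu|], and the two variations are
[cover_null]. *)
Lemma radon_le_of_proper (m1 m2 : {measure set (borel X) -> \bar R}) nu lam K :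
  is_radon m1 -> is_radon m2 ->
  additive_compact nu -> sf_norm nu < +oo -> is_proper nu ->
  additive_compact lam -> sf_norm lam < +oo -> is_proper lam ->
  (forall C, compact C -> m1 C + nu C = m2 C + lam C) ->
  compact K -> m1 K <= m2 K.
Proof.
move=> r1 r2 nua nuf nup lama lamf lamp E cK.
have S1 := sf_variation_superadditive nua nuf.
have S2 := sf_variation_superadditive lama lamf.
apply: (radon_le_of_cover_null X_haus r1 (superadditiveD S1 S2) _ _ _ _ _ cK).
- by apply: cover_nullD => //; exact: proper_variation_cover_null.
- by move=> C _; exact: measure_ge0.
- by move=> C D cC cD CD; apply: le_measure; rewrite ?inE//; exact: compact_borel.
- move=> C D cC cD CD.
  by rewrite (measureU m2 (compact_borel X_haus cC) (compact_borel X_haus cD) CD).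
move=> C U cC oU CU.
apply: (@le_trans _ _ (`|nu C| + `|lam C| + m2 C)); last first.
  by apply: leeD => //; apply: leeD; exact: le_sf_variation_open.
have := E C cC; have := radon_compact_fin r1 cC; have := radon_compact_fin r2 cC.
have := sf_norm_fin nuf cC; have := sf_norm_fin lamf cC.
case: (m1 C) (m2 C) (nu C) (lam C) => [a||] [b||]// [c||]// [d||]// _ _ _ _.
rewrite -!EFinD => -[abcd]; rewrite lee_fin.
have -> : a = (- c + d + b)%R by lra.
apply: lerD => //; apply: lerD; last exact: ler_norm.
by rewrite -normrN; exact: ler_norm.
Qed.

(** Moving the negative parts across turns the equality of two decompositions
into [m1 + n2 + mu' = n1 + m2 + nu'], to which [radon_le_of_proper] applies in both
directions. *)
Lemma decomposition_unique mu m mu' n nu' :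
  is_sum_oc mu m mu' -> is_signed_radon m -> additive_compact mu' ->
  is_proper mu' -> sf_norm m < +oo -> sf_norm mu' < +oo ->
  is_sum_oc mu n nu' -> is_signed_radon n -> additive_compact nu' ->
  is_proper nu' -> sf_norm n < +oo -> sf_norm nu' < +oo ->
  eq_oc n m /\ eq_oc nu' mu'.
Proof.
move=> sm rm am pm fm fm' sn rn an pn fn fn'.
have [m1 [m2 [rm1 rm2 fm1 fm2 mE]]] := signed_radon_finite rm fm.
have [n1 [n2 [rn1 rn2 fn1 fn2 nE]]] := signed_radon_finite rn fn.
have [a ra aE] := radonD X_haus rm1 rn2.
have [b rb bE] := radonD X_haus rn1 rm2.
have ab K : compact K -> a K + mu' K = b K + nu' K.
  move=> cK; have ocK := compact_open_or_closed X_haus cK.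
  have [_ ] := sm K ocK; have [_ ->] := sn K ocK.
  have [_ ->] := mE K ocK; have [_ ->] := nE K ocK; rewrite aE bE.
  have := radon_compact_fin rm1 cK; have := radon_compact_fin rm2 cK.
  have := radon_compact_fin rn1 cK; have := radon_compact_fin rn2 cK.
  have := sf_norm_fin fm' cK; have := sf_norm_fin fn' cK.
  case: (nu' K) (mu' K) => [x||] [y||]// _ _.
  case: (m1 K) (m2 K) (n1 K) (n2 K) => [p||] [q||]// [r||]// [s||]// _ _ _ _.
  rewrite -!(EFinD, EFinN, EFinB) => -[H]; congr EFin; lra.
have aboc A : open_or_closed A -> a A = b A.
  apply: radon_eq_oc => // K cK; apply/eqP; rewrite eq_le; apply/andP; split.
    by apply: (radon_le_of_proper ra rb am fm' pm an fn' pn ab cK).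
  apply: (radon_le_of_proper rb ra an fn' pn am fm' pm _ cK) => C cC.
  by rewrite ab.
have mn A : open_or_closed A -> n A = m A /\ m A \is a fin_num.
  move=> ocA; have mA := open_or_closed_borel ocA.
  have := aboc A ocA; rewrite aE bE.
  have [_ ->] := mE A ocA; have [_ ->] := nE A ocA.
  have := measure_fin_num fm1 mA; have := measure_fin_num fm2 mA.
  have := measure_fin_num fn1 mA; have := measure_fin_num fn2 mA.
  case: (m1 A) (m2 A) (n1 A) (n2 A) => [p||] [q||]// [r||]// [s||]// _ _ _ _.
  rewrite -!(EFinD, EFinN, EFinB) => -[H]; split => //; congr EFin; lra.
split=> A ocA; have [nmA mfin] := mn A ocA; first exact: nmA.
have [_ ] := sm A ocA; have [_ ->] := sn A ocA; rewrite nmA.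
by move=> /(congr1 (fun z => z - m A)); rewrite ![m A + _]addeC !addeK.
Qed.

End uniqueness.

(** * Finiteness and signed topological measures *)

Section signed_tm.
Context {R : realType} {X : ptopologicalType}.
Hypothesis X_haus : hausdorff_space X.

Lemma open_or_compact_oc (A : set X) : open_or_compact A -> open_or_closed A.
Proof. by move=> [oA|cA]; [left|right; exact: compact_closed]. Qed.

Lemma stm_additive_compact (mu : set X -> \bar R) : is_signed_tm mu ->
  additive_compact mu.
Proof.
move=> muT C K cC cK CK; apply: (stm_additive muT) => //; right => //.
exact: compactU.
Qed.

(** A finite signed measure is additive on all Borel sets, so subtracting it
preserves additivity on open and compact sets. *)
Lemma signed_tm_subr (mu mu' : set X -> \bar R)
    (m1 m2 : {measure set (borel X) -> \bar R}) :
  is_signed_tm mu -> sf_finite (m1 : set X -> \bar R) ->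
  sf_finite (m2 : set X -> \bar R) -> is_signed_dtm mu' ->
  is_sum_oc mu (fun A => m1 A - m2 A) mu' -> is_signed_tm mu'.
Proof.
move=> muT f1 f2 [mi mp mn ma mo mc] sum; split => //.
move=> A B ocA ocB ocAB AB.
have bA := open_or_closed_borel (open_or_compact_oc ocA).
have bB := open_or_closed_borel (open_or_compact_oc ocB).
have := stm_additive muT ocA ocB ocAB AB.
have [_ ->] := sum _ (open_or_compact_oc ocA).
have [_ ->] := sum _ (open_or_compact_oc ocB).
have [_ ->] := sum _ (open_or_compact_oc ocAB).
have e1 : m1 (A `|` B) = m1 A + m1 B by exact: measureU.
have e2 : m2 (A `|` B) = m2 A + m2 B by exact: measureU.
rewrite e1 e2.
have := measure_fin_num f1 bA; have := measure_fin_num f1 bB.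
have := measure_fin_num f2 bA; have := measure_fin_num f2 bB.
case: (m1 A) (m1 B) (m2 A) (m2 B) => [p||] [q||]// [r||]// [s||]// _ _ _ _.
case: (mu' A) (mu' B) (mu' (A `|` B)) => [x||] [y||] [z||]//.
rewrite -!(EFinD, EFinN, EFinB) => -[H]; congr EFin; lra.
Qed.

(** A bounded difference with one bounded term has both terms bounded. *)
Lemma dtm_finite_of_norm (mu mu1 mu2 : set X -> \bar R) :
  is_dtm mu1 -> is_dtm mu2 -> is_diff_oc mu mu1 mu2 -> sf_norm mu < +oo ->
  sf_finite mu1 \/ sf_finite mu2 -> sf_finite mu1 /\ sf_finite mu2.
Proof.
move=> d1 d2 muE muf fin.
have bound (nu lam : set X -> \bar R) : is_dtm nu -> is_dtm lam -> sf_finite lam ->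
    (forall K, compact K -> nu K <= lam K + `|mu K|) -> sf_finite nu.
  move=> nud lamd lamf nule; rewrite /sf_finite (dtm_open nud openT).
  apply: (@le_lt_trans _ _ (lam setT + sf_norm mu)); last exact: lte_add_pinfty.
  apply/ereal_supP => _ [K [cK _] <-]; apply: le_trans (nule K cK) _.
  apply: leeD; last exact: le_sf_norm.
  apply: dtm_mono => //; first exact: compact_open_or_closed.
  exact: open_or_closedT.
case: fin => f; split => //.
  apply: (bound _ mu1) => // K cK; have ocK := compact_open_or_closed X_haus cK.
  have [_ ->] := muE K ocK; have := dtm_ge0 d2 ocK.
  have := dtm_fin_num d1 f ocK.
  case: (mu1 K) (mu2 K) => [a||] [b||]// _ _.
  rewrite -EFinB abse_EFin -EFinD lee_fin -lerBlDl distrC; exact: ler_norm.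
apply: (bound _ mu2) => // K cK; have ocK := compact_open_or_closed X_haus cK.
have [_ ->] := muE K ocK; have := dtm_ge0 d1 ocK.
have := dtm_fin_num d2 f ocK.
case: (mu1 K) (mu2 K) => [a||] [b||]// _ _.
rewrite -EFinB abse_EFin -EFinD lee_fin -lerBlDl; exact: ler_norm.
Qed.

Lemma sf_finite_singleton_finite (nu : set X -> \bar R) : is_dtm nu ->
  sf_finite nu -> singleton_finite nu.
Proof.
by move=> nud nuf x; apply: (dtm_singleton X_haus nud open_or_closedT) nuf.
Qed.

Lemma radon_diff_norm (m1 m2 : {measure set (borel X) -> \bar R}) :
  sf_finite (m1 : set X -> \bar R) -> sf_finite (m2 : set X -> \bar R) ->
  sf_norm (fun A : set X => m1 A - m2 A) < +oo.
Proof.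
move=> f1 f2.
apply: (@le_lt_trans _ _ (m1 setT + m2 setT)); last exact: lte_add_pinfty.
apply/ereal_supP => _ [K cK <-]; apply: le_trans (lee_abs_sub _ _) _.
rewrite !gee0_abs ?measure_ge0//.
by apply: leeD; apply: le_measure; rewrite ?inE//; exact: compact_borel.
Qed.

End signed_tm.

(** * The decomposition theorem *)

Theorem theorem5p3 (R : realType) (X : ptopologicalType)
    (X_lc : locally_compact [set: X]) (X_conn : connected [set: X])
    (X_haus : hausdorff_space X)
    (mu : set X -> \bar R)
    (mu_sdtm : is_signed_dtm mu) (mu_sf : singleton_finite mu)
    (mu_diff : exists mu1 mu2 : set X -> \bar R,
      [/\ is_dtm mu1, is_dtm mu2,
          (singleton_finite mu1 /\ sf_finite mu2) \/
          (sf_finite mu1 /\ singleton_finite mu2)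
        & is_diff_oc mu mu1 mu2]) :
  [/\ exists m mu' : set X -> \bar R,
        [/\ is_sum_oc mu m mu', is_signed_radon m,
            is_signed_dtm mu', singleton_finite mu' & is_proper mu'],
      (exists mu1 mu2 : set X -> \bar R,
        [/\ is_dtm mu1, is_dtm mu2, sf_finite mu1, sf_finite mu2
          & is_diff_oc mu mu1 mu2]) ->
      unique_decomposition (fun m mu' : set X -> \bar R =>
        [/\ is_sum_oc mu m mu', is_signed_radon m,
            is_signed_dtm mu' /\ is_proper mu',
            sf_norm m < +oo & sf_norm mu' < +oo])
    & is_signed_tm mu -> sf_norm mu < +oo ->
      unique_decomposition (fun m mu' : set X -> \bar R =>
        [/\ is_sum_oc mu m mu', is_signed_radon m,
            is_signed_tm mu' /\ is_proper mu',
            sf_norm m < +oo & sf_norm mu' < +oo])].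
Proof.
have [mu1 [mu2 [d1 d2 fin muE]]] := mu_diff.
have sfin := @sf_finite_singleton_finite R X X_haus.
have [s1 s2 f12] : [/\ singleton_finite mu1, singleton_finite mu2 &
    sf_finite mu1 \/ sf_finite mu2].
  case: fin => -[? ?]; first by split; [|exact: sfin|right].
  by split; [exact: sfin| |left].
have decomp nu1 nu2 : is_dtm nu1 -> is_dtm nu2 -> sf_finite nu1 ->
    sf_finite nu2 -> is_diff_oc mu nu1 nu2 ->
    exists (m1 m2 : {measure set (borel X) -> \bar R}) mu',
    [/\ is_sum_oc mu (fun A => m1 A - m2 A) mu',
        is_signed_radon (fun A => m1 A - m2 A),
        is_signed_dtm mu' /\ is_proper mu',
        sf_finite (m1 : set X -> \bar R) /\ sf_finite (m2 : set X -> \bar R) &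
        sf_norm mu' < +oo].
  move=> dn1 dn2 fn1 fn2 nuE.
  have [m1 [m2 [mu' [[r1 r2 f dif] sum [sd _ pr] nf]]]] :=
    signed_dtm_decomposition X_haus X_lc dn1 dn2 (sfin _ dn1 fn1) (sfin _ dn2 fn2)
      (or_introl fn1) nuE.
  have [g1 g2 g'] := nf fn1 fn2.
  by exists m1, m2, mu'; split => //; exists m1, m2.
split.
- have [m1 [m2 [mu' [[r1 r2 f dif] sum [sd sg pr] _]]]] :=
    signed_dtm_decomposition X_haus X_lc d1 d2 s1 s2 f12 muE.
  by exists (fun A => m1 A - m2 A), mu'; split => //; exists m1, m2.
- move=> [nu1 [nu2 [dn1 dn2 fn1 fn2 nuE]]].
  have [m1 [m2 [mu' [sum sr [sd pr] [f1 f2] f']]]] :=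
    decomp _ _ dn1 dn2 fn1 fn2 nuE.
  have fm := radon_diff_norm X_haus f1 f2.
  exists (fun A => m1 A - m2 A), mu'; split => // n nu'.
  move=> [sumn rn [sdn prn] fn fnu].
  exact: (decomposition_unique X_haus X_lc sum sr (sdtm_additive sd) pr fm f'
    sumn rn (sdtm_additive sdn)).
- move=> muT muf.
  have [fn1 fn2] := dtm_finite_of_norm X_haus d1 d2 muE muf f12.
  have [m1 [m2 [mu' [sum sr [sd pr] [f1 f2] f']]]] :=
    decomp _ _ d1 d2 fn1 fn2 muE.
  have fm := radon_diff_norm X_haus f1 f2.
  exists (fun A => m1 A - m2 A), mu'; split.
    by split => //; split => //; exact: (signed_tm_subr X_haus muT f1 f2 sd sum).
  move=> n nu' [sumn rn [sdn prn] fn fnu].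
  exact: (decomposition_unique X_haus X_lc sum sr (sdtm_additive sd) pr fm f'
    sumn rn (stm_additive_compact sdn)).
Qed.
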